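(* Let $M$ be an $R$-module and $(t_n)_{n\ge1}$ a Markov trace on the tower $(\widetilde{BMW}_n)_{n\ge 1}$ with values in $M$. If $x(a^2-y^2)$ and $x^2(a^2-y)$ are invertible in $M$ (i.e. act bijectively on $M$, so that $M$ is naturally an $S$-module), then $(t_n)$ is a multiple of $(t_n^H)$: there exists $m\in M$ such that $t_n(\beta)=t_n^H(\beta)\,m$ for all $n\ge 1$ and all $\beta\in\widetilde{BMW}_n$.
   Context: $R=\mathbb{Q}[a,b,c,(abc)^{-1}]$, $x=b+c$, $y=bc$, $S=R[x^{-1}]$. $H_n$ is the quotient of the group algebra $RB_n$ of the braid group (Artin generators $s_1,\dots,s_{n-1}$) by the relations $(s_i-a)(s_i-b)(s_i-c)=0$. $\widetilde{BMW}_n$ is the quotient of $H_n$ by the two-sided ideal generated by $$\mathcal{R}_i=-y\,s_is_{i+1}^{-1}s_i+y^2s_{i+1}^{-1}s_is_{i+1}^{-1}-s_is_{i+1}s_i-xy^2s_{i+1}^{-2}+x\,s_i^2+y^3s_{i+1}^{-1}s_i^{-1}s_{i+1}^{-1},\quad 1\le i\le n-2.$$ A Markov trace on $(\widetilde{BMW}_n)_{n\ge1}$ with values in an $R$-module $M$ is a sequence of $R$-linear maps $t_n:\widetilde{BMW}_n\to M$ with $t_n(uv)=t_n(vu)$ and $t_{n+1}(\iota_n(u)s_n^{\pm1})=t_n(u)$ for all $u,v\in\widetilde{BMW}_n$, where $\iota_n:\widetilde{BMW}_n\to\widetilde{BMW}_{n+1}$ is $s_i\mapsto s_i$. $(t_n^H)$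 is the Ocneanu trace: let $\mathcal{H}_n(b,c)$ be the quotient of $RB_n$ by $(s_i-b)(s_i-c)=0$; the projection $H_n\to\mathcal{H}_n(b,c)$ factors through $\widetilde{BMW}_n$, and $t_n^H:\widetilde{BMW}_n\to S$ is the Markov trace factoring through $(\mathcal{H}_n(b,c))$ normalized by $t_1^H(1)=1$ (classically it exists and is unique; e.g. $t_n^H(1)=((y+1)/x)^{n-1}$). *)

(* Defs.v *)
From HB Require Import structures.
From mathcomp Require Import all_boot all_order all_algebra.
From mathcomp Require Import ring.
From mathcomp Require Import generic_quotient ring_quotient fraction.
From mathcomp Require Import finmap boolp classical_sets.
From mathcomp Require Import monalg.

Set Implicit Arguments.
Unset Strict Implicit.
Unset Printing Implicit Defensive.

Import GRing.Theory.
Local Open Scope ring_scope.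
Local Open Scope quotient_scope.

(* The letter (i, false) stands for the generator i and (i, true) for its
   inverse; a relation [rels l r] identifies the words l and r. *)
Section PresentedGroup.
Variables (I : choiceType) (rels : seq (I * bool) -> seq (I * bool) -> Prop).
Local Notation word := (seq (I * bool)).

Inductive word_eq : word -> word -> Prop :=
| word_eq_refl u : word_eq u u
| word_eq_sym u v : word_eq u v -> word_eq v u
| word_eq_trans u v w : word_eq u v -> word_eq v w -> word_eq u w
| word_eq_cancel u v i e : word_eq (u ++ (i, e) :: (i, ~~ e) :: v) (u ++ v)
| word_eq_rel u v l r : rels l r -> word_eq (u ++ l ++ v) (u ++ r ++ v).

Definition word_eqb : rel word := fun u v => `[< word_eq u v >].

Lemma word_eqb_equiv : equiv_class_of word_eqb.
Proof.
split=> [u|u v|v u w].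
- exact/asboolP/word_eq_refl.
- by apply/asboolP/asboolP; exact: word_eq_sym.
- by move=> /asboolP uv /asboolP vw; apply/asboolP; exact: word_eq_trans vw.
Qed.
Canonical word_eqb_equivRel := EquivRelPack word_eqb_equiv.
Canonical word_eqb_encModRel := defaultEncModRel word_eqb.

Definition presg := {eq_quot word_eqb}.
HB.instance Definition _ : EqQuotient word word_eqb presg :=
  EqQuotient.on presg.
HB.instance Definition _ := Choice.on presg.

Definition pword : word -> presg := locked (fun u => \pi_presg u).

Lemma pwordE u : pword u = \pi_presg u.
Proof. by rewrite /pword -lock. Qed.

Lemma pwordP u v : pword u = pword v <-> word_eq u v.
Proof.
rewrite !pwordE; split=> [/eqP|h]; first by rewrite piE => /asboolP.
by apply/eqP; rewrite piE; exact/asboolP.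
Qed.

Lemma pword_repr (g : presg) : pword (repr g) = g.
Proof. by rewrite pwordE reprK. Qed.

Lemma word_eq_cat u u' v v' :
  word_eq u u' -> word_eq v v' -> word_eq (u ++ v) (u' ++ v').
Proof.
move=> hu hv; apply: (@word_eq_trans _ (u' ++ v)).
  elim: hu => [w|w w' _|w1 w2 w3 _ IH1 _|w w' i e|w w' l r h].
  - exact: word_eq_refl.
  - exact: word_eq_sym.
  - exact: word_eq_trans.
  - by rewrite -!catA /=; exact: word_eq_cancel.
  - by rewrite -!catA; exact: word_eq_rel.
elim: hv => [w|w w' _|w1 w2 w3 _ IH1 _|w w' i e|w w' l r h].
- exact: word_eq_refl.
- exact: word_eq_sym.
- exact: word_eq_trans.
- by rewrite !catA; exact: word_eq_cancel.
- by rewrite !(catA u'); exact: word_eq_rel.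
Qed.

Definition word_inv (u : word) : word := rev [seq (l.1, ~~ l.2) | l <- u].

Lemma word_invK : involutive word_inv.
Proof.
move=> u; rewrite /word_inv map_rev revK -map_comp -[RHS]map_id.
by apply: eq_map => -[i e] /=; rewrite negbK.
Qed.

Lemma word_eq_mulV u : word_eq (u ++ word_inv u) [::].
Proof.
elim/last_ind: u => [|u [i e] IH]; first exact: word_eq_refl.
rewrite /word_inv map_rcons rev_rcons cat_rcons /=.
exact: word_eq_trans (word_eq_cancel _ _ _ _) IH.
Qed.

Lemma word_eq_mulVl u : word_eq (word_inv u ++ u) [::].
Proof. by rewrite -{2}(word_invK u); exact: word_eq_mulV. Qed.

Definition presg_one : presg := pword [::].
Definition presg_mul : presg -> presg -> presg :=
  locked (fun g h => pword (repr g ++ repr h)).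
Definition presg_inv : presg -> presg :=
  locked (fun g => pword (word_inv (repr g))).

Lemma pword_cat u v : presg_mul (pword u) (pword v) = pword (u ++ v).
Proof. by rewrite /presg_mul -lock; apply/pwordP/word_eq_cat; apply/pwordP; exact: pword_repr. Qed.

Lemma presg_mulA : associative presg_mul.
Proof.
move=> g h k; rewrite -(pword_repr g) -(pword_repr h) -(pword_repr k).
by rewrite !pword_cat catA.
Qed.
Lemma presg_mul1 : left_id presg_one presg_mul.
Proof. by move=> g; rewrite -(pword_repr g) pword_cat. Qed.
Lemma presg_mulr1 : right_id presg_one presg_mul.
Proof. by move=> g; rewrite -(pword_repr g) pword_cat cats0. Qed.
Lemma presg_mulV : left_inverse presg_one presg_inv presg_mul.
Proof.
move=> g; rewrite /presg_inv -lock -{2}(pword_repr g) pword_cat; apply/pwordP.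
exact: word_eq_mulVl.
Qed.
Lemma presg_mulrV : right_inverse presg_one presg_inv presg_mul.
Proof.
move=> g; rewrite /presg_inv -lock -{1}(pword_repr g) pword_cat; apply/pwordP.
exact: word_eq_mulV.
Qed.

HB.instance Definition _ := isGroup.Build presg
  presg_mulA presg_mul1 presg_mulr1 presg_mulV presg_mulrV.

Definition pgen (i : I) : presg := pword [:: (i, false)].

Lemma pwordM u v : pword (u ++ v) = (pword u * pword v)%g.
Proof. by rewrite -pword_cat. Qed.

Lemma pword_inv (i : I) : pword [:: (i, true)] = ((pgen i)^-1)%g.
Proof.
apply: (mulgI (pgen i)); rewrite mulgV -pwordM /=.
exact/pwordP/(word_eq_cancel [::] [::] i false).
Qed.

Section Lift.
Variables (G : groupType) (f : I -> G).

Definition word_val (u : word) : G :=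
  foldr (fun l x => ((if l.2 then (f l.1)^-1 else f l.1) * x)%g) 1%g u.

Lemma word_val_cat u v : word_val (u ++ v) = (word_val u * word_val v)%g.
Proof. by elim: u => [|l u IH] /=; rewrite ?mul1g // IH mulgA. Qed.

Definition presg_lift (g : presg) : G := word_val (repr g).

Hypothesis frel : forall l r, rels l r -> word_val l = word_val r.

Lemma word_val_eq u v : word_eq u v -> word_val u = word_val v.
Proof.
elim=> {u v} [//|u v _ -> //|u v w _ -> _ -> //|u v i e|u v l r h].
  by rewrite !word_val_cat; case: e; rewrite /= ?mulKg ?mulVKg.
by rewrite !word_val_cat (frel h).
Qed.

Lemma presg_lift_word u : presg_lift (pword u) = word_val u.
Proof. by apply: word_val_eq; apply/pwordP; exact: pword_repr. Qed.

Lemma presg_lift_gen i : presg_lift (pgen i) = f i.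
Proof. by rewrite presg_lift_word /= mulg1. Qed.

Lemma presg_lift1 : presg_lift 1%g = 1%g.
Proof. exact: (presg_lift_word [::]). Qed.

Lemma presg_liftM : {morph presg_lift : g h / (g * h)%g}.
Proof.
move=> g h; rewrite -(pword_repr g) -(pword_repr h) -pwordM.
by rewrite !presg_lift_word word_val_cat.
Qed.

Lemma presg_liftV g : presg_lift g^-1%g = ((presg_lift g)^-1)%g.
Proof. by apply: (mulgI (presg_lift g)); rewrite -presg_liftM !mulgV presg_lift1. Qed.

End Lift.
End PresentedGroup.

(* B_n has n - 1 generators; s_1, ..., s_(n-1) are numbered from 0 here. *)
Inductive braid_rel (n : nat) :
  seq ('I_n.-1 * bool) -> seq ('I_n.-1 * bool) -> Prop :=
| braid_rel_far (i j : 'I_n.-1) : (i.+1 < j)%N ->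
    braid_rel [:: (i, false); (j, false)] [:: (j, false); (i, false)]
| braid_rel_near (i j : 'I_n.-1) : j = i.+1 :> nat ->
    braid_rel [:: (i, false); (j, false); (i, false)]
              [:: (j, false); (i, false); (j, false)].

Definition braid (n : nat) := presg (@braid_rel n).
HB.instance Definition _ n := Group.on (braid n).

Definition artin (n : nat) (i : 'I_n.-1) : braid n := pgen (@braid_rel n) i.

Definition braid_incl (n : nat) : braid n -> braid n.+1 :=
  @presg_lift _ (@braid_rel n) (braid n.+1)
    (fun i => @artin n.+1 (widen_ord (leq_pred n) i)).

Lemma artin_far n (i j : 'I_n.-1) : (i.+1 < j)%N ->
  (artin i * artin j = artin j * artin i)%g.
Proof.
move=> h; rewrite -!pwordM; apply/pwordP.
exact: (word_eq_rel [::] [::] (braid_rel_far h)).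
Qed.

Lemma artin_near n (i j : 'I_n.-1) : j = i.+1 :> nat ->
  (artin i * (artin j * artin i) = artin j * (artin i * artin j))%g.
Proof.
move=> h; pose w (k : 'I_n.-1) : seq ('I_n.-1 * bool) := [:: (k, false)].
have E k l : (artin k * (artin l * artin k))%g = pword _ (w k ++ (w l ++ w k)).
  by rewrite !pwordM.
rewrite !E; apply/pwordP.
exact: (word_eq_rel [::] [::] (braid_rel_near h)).
Qed.

Lemma braid_incl_rel n l r : @braid_rel n l r ->
  word_val (fun i => @artin n.+1 (widen_ord (leq_pred n) i)) l =
  word_val (fun i => @artin n.+1 (widen_ord (leq_pred n) i)) r.
Proof.
case=> i j h /=; rewrite !mulg1; first exact: artin_far.
exact: artin_near.
Qed.

Lemma braid_incl_artin n (i : 'I_n.-1) :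
  braid_incl (artin i) = @artin n.+1 (widen_ord (leq_pred n) i).
Proof. exact: presg_lift_gen (@braid_incl_rel n) _. Qed.

Lemma braid_incl1 n : @braid_incl n 1%g = 1%g.
Proof. exact: presg_lift1 (@braid_incl_rel n). Qed.

Lemma braid_inclM n : {morph @braid_incl n : g h / (g * h)%g}.
Proof. exact: presg_liftM (@braid_incl_rel n). Qed.

Lemma braid_inclV n (g : braid n) : braid_incl g^-1%g = ((braid_incl g)^-1)%g.
Proof. exact: presg_liftV (@braid_incl_rel n) g. Qed.

(* The ring structure of {malg R[K]} requires K to be a monoid without
   non-trivial units, so the convolution product is redone for groups. *)
Section RawGroupAlgebra.
Variables (R : comNzRingType) (G : groupType).

Definition rgalg := {malg R[G]}.
HB.instance Definition _ := GRing.Lmodule.on rgalg.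

Definition rgdelta (g : G) : rgalg := << 1 *g g >>.

Definition rgalg_mul (u v : rgalg) : rgalg :=
  \sum_(g <- msupp u) \sum_(h <- msupp v) << u@_g * v@_h *g (g * h)%g >>.

Lemma rgalg_mulw (d1 d2 : {fset G}) (u v : rgalg) :
  (msupp u `<=` d1)%fset -> (msupp v `<=` d2)%fset ->
  rgalg_mul u v = \sum_(g <- d1) \sum_(h <- d2) << u@_g * v@_h *g (g * h)%g >>.
Proof.
move=> le_d1 le_d2; rewrite /rgalg_mul (big_fset_incl _ le_d1) /=.
  apply/eq_bigr=> k1 _; apply/big_fset_incl => // k _ /mcoeff_outdom ->.
  by rewrite mulr0 monalgU0.
move=> k _ /mcoeff_outdom g1k.
by rewrite big1 => // k' _; rewrite g1k mul0r monalgU0.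
Qed.

Lemma rgalg_mulDl : left_distributive rgalg_mul +%R.
Proof.
move=> u v w.
rewrite (rgalg_mulw (fsubsetUl (msupp u) (msupp v)) (fsubset_refl (msupp w))).
rewrite (rgalg_mulw (fsubsetUr (msupp u) (msupp v)) (fsubset_refl (msupp w))).
rewrite (rgalg_mulw (msuppD_le u v) (fsubset_refl (msupp w))).
rewrite -big_split /=; apply/eq_bigr=> k1 _.
rewrite -big_split /=; apply/eq_bigr=> k2 _.
by rewrite mcoeffD mulrDl monalgUD.
Qed.

Lemma rgalg_mulDr : right_distributive rgalg_mul +%R.
Proof.
move=> u v w.
rewrite (rgalg_mulw (fsubset_refl (msupp u)) (fsubsetUl (msupp v) (msupp w))).
rewrite (rgalg_mulw (fsubset_refl (msupp u)) (fsubsetUr (msupp v) (msupp w))).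
rewrite (rgalg_mulw (fsubset_refl (msupp u)) (msuppD_le v w)).
rewrite -big_split /=; apply/eq_bigr=> k1 _.
rewrite -big_split /=; apply/eq_bigr=> k2 _.
by rewrite mcoeffD mulrDr monalgUD.
Qed.

Lemma rgalg_mul0 (u : rgalg) : rgalg_mul 0 u = 0.
Proof. by rewrite /rgalg_mul msupp0 big_seq_fset0. Qed.

Lemma rgalg_mulr0 (u : rgalg) : rgalg_mul u 0 = 0.
Proof.
by rewrite /rgalg_mul big1 // => g _; rewrite msupp0 big_seq_fset0.
Qed.

Lemma rgalg_mulUU (c d : R) (g h : G) :
  rgalg_mul << c *g g >> << d *g h >> = << c * d *g (g * h)%g >>.
Proof.
by rewrite (rgalg_mulw msuppU_le msuppU_le) !big_seq_fset1 !mcoeffUU.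
Qed.

Lemma rgalg_ind (P : rgalg -> Prop) : P 0 ->
  (forall c g, P << c *g g >>) -> (forall u v, P u -> P v -> P (u + v)) ->
  forall u, P u.
Proof. by move=> P0 PU PD u; rewrite [u]monalgE; apply: big_ind. Qed.

Lemma rgalg_mulA : associative rgalg_mul.
Proof.
move=> u v w; elim/rgalg_ind: u => [|c g|u u' IH IH'].
- by rewrite !rgalg_mul0.
- elim/rgalg_ind: v => [|d h|v v' IH IH'].
  + by rewrite rgalg_mul0 rgalg_mulr0 rgalg_mul0.
  + elim/rgalg_ind: w => [|e k|w w' IH IH'].
    * by rewrite !rgalg_mulr0.
    * by rewrite !rgalg_mulUU mulrA mulgA.
    * by rewrite !rgalg_mulDr IH IH'.
  + by rewrite rgalg_mulDl !rgalg_mulDr rgalg_mulDl IH IH'.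
- by rewrite !rgalg_mulDl IH IH'.
Qed.

Lemma rgalg_mul1 : left_id (rgdelta 1%g) rgalg_mul.
Proof.
elim/rgalg_ind=> [|c g|u v IH IH']; first exact: rgalg_mulr0.
- by rewrite rgalg_mulUU mul1r mul1g.
- by rewrite rgalg_mulDr IH IH'.
Qed.

Lemma rgalg_mulr1 : right_id (rgdelta 1%g) rgalg_mul.
Proof.
elim/rgalg_ind=> [|c g|u v IH IH']; first exact: rgalg_mul0.
- by rewrite rgalg_mulUU mulr1 mulg1.
- by rewrite rgalg_mulDl IH IH'.
Qed.

Lemma rgalg_one_neq0 : rgdelta 1%g != 0.
Proof. by rewrite monalgU_eq0 oner_eq0. Qed.

HB.instance Definition _ := GRing.Zmodule_isNzRing.Build rgalg
  rgalg_mulA rgalg_mul1 rgalg_mulr1 rgalg_mulDl rgalg_mulDr rgalg_one_neq0.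

Lemma rgalg_MU (c d : R) (g h : G) :
  (<< c *g g >> : rgalg) * << d *g h >> = << c * d *g (g * h)%g >>.
Proof. exact: rgalg_mulUU. Qed.

Lemma rgalg_scaleU (k c : R) (g : G) : k *: (<< c *g g >> : rgalg) = << k * c *g g >>.
Proof. by apply/malgP=> h; rewrite mcoeffZ !mcoeffU mulrnAr. Qed.

Lemma rgalg_scaleAl (k : R) (u v : rgalg) : k *: (u * v) = (k *: u) * v.
Proof.
elim/rgalg_ind: u => [|c g|u u' IH IH']; first by rewrite mul0r !scaler0 mul0r.
- elim/rgalg_ind: v => [|d h|v v' IH IH']; first by rewrite !mulr0 scaler0.
  + by rewrite rgalg_scaleU !rgalg_MU rgalg_scaleU mulrA.
  + by rewrite !mulrDr scalerDr IH IH'.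
- by rewrite mulrDl !scalerDr mulrDl IH IH'.
Qed.

Lemma rgalg_scaleAr (k : R) (u v : rgalg) : k *: (u * v) = u * (k *: v).
Proof.
elim/rgalg_ind: u => [|c g|u u' IH IH']; first by rewrite !mul0r scaler0.
- elim/rgalg_ind: v => [|d h|v v' IH IH'].
  + by rewrite mulr0 scaler0 mulr0.
  + by rewrite rgalg_scaleU !rgalg_MU rgalg_scaleU mulrCA.
  + by rewrite mulrDr !scalerDr mulrDr IH IH'.
- by rewrite !mulrDl scalerDr IH IH'.
Qed.

HB.instance Definition _ := GRing.LSemiModule_isLSemiAlgebra.Build R rgalg
  rgalg_scaleAl.
HB.instance Definition _ := GRing.LSemiAlgebra_isSemiAlgebra.Build R rgalg
  rgalg_scaleAr.

Section Lift.
Variables (A : algType R) (f : G -> A).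

Definition rgalg_lift (u : rgalg) : A := \sum_(g <- msupp u) u@_g *: f g.

Lemma rgalg_liftw (d : {fset G}) (u : rgalg) : (msupp u `<=` d)%fset ->
  rgalg_lift u = \sum_(g <- d) u@_g *: f g.
Proof.
move=> le_d; apply: big_fset_incl => // g _ /mcoeff_outdom ->.
by rewrite scale0r.
Qed.

Lemma rgalg_liftU c g : rgalg_lift << c *g g >> = c *: f g.
Proof. by rewrite (rgalg_liftw msuppU_le) big_seq_fset1 mcoeffUU. Qed.

Lemma rgalg_lift_linear : linear rgalg_lift.
Proof.
move=> k u v.
rewrite (rgalg_liftw (fsubsetUl (msupp u) (msupp v))).
rewrite (rgalg_liftw (fsubsetUr (msupp u) (msupp v))).
rewrite (@rgalg_liftw (msupp u `|` msupp v)%fset); last first.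
  exact: fsubset_trans (msuppD_le _ _) (fsetSU _ (msuppZ_le _ _)).
rewrite scaler_sumr -big_split /=; apply: eq_bigr => g _.
by rewrite mcoeffD mcoeffZ scalerDl scalerA.
Qed.

End Lift.
End RawGroupAlgebra.

(* The group algebra proper: the same operations, locked so that unification
   does not unfold them. *)
Section GroupAlgebra.
Variables (R : comNzRingType) (G : groupType).

Definition galg : Type := rgalg R G.
HB.instance Definition _ := Choice.on galg.

Definition galg_zero : galg := locked (0 : rgalg R G).
Definition galg_opp : galg -> galg := locked (-%R : rgalg R G -> rgalg R G).
Definition galg_add : galg -> galg -> galg :=
  locked (+%R : rgalg R G -> rgalg R G -> rgalg R G).
Definition galg_one : galg := locked (1 : rgalg R G).
Definition galg_mul : galg -> galg -> galg :=
  locked ( *%R : rgalg R G -> rgalg R G -> rgalg R G).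
Definition galg_scale : R -> galg -> galg :=
  locked ( *:%R : R -> rgalg R G -> rgalg R G).
Definition gdelta : G -> galg := locked (@rgdelta R G).

Lemma galg_addA : associative galg_add.
Proof. by rewrite /galg_add -lock; exact: addrA. Qed.
Lemma galg_addC : commutative galg_add.
Proof. by rewrite /galg_add -lock; exact: addrC. Qed.
Lemma galg_add0 : left_id galg_zero galg_add.
Proof. by rewrite /galg_add /galg_zero -!lock; exact: add0r. Qed.
Lemma galg_addN : left_inverse galg_zero galg_opp galg_add.
Proof. by rewrite /galg_add /galg_zero /galg_opp -!lock; exact: addNr. Qed.
HB.instance Definition _ := GRing.isZmodule.Build galg
  galg_addA galg_addC galg_add0 galg_addN.

Lemma galg_mulA : associative galg_mul.
Proof. by rewrite /galg_mul -lock; exact: mulrA. Qed.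
Lemma galg_mul1 : left_id galg_one galg_mul.
Proof. by rewrite /galg_mul /galg_one -!lock; exact: mul1r. Qed.
Lemma galg_mulr1 : right_id galg_one galg_mul.
Proof. by rewrite /galg_mul /galg_one -!lock; exact: mulr1. Qed.
Lemma galg_mulDl : left_distributive galg_mul galg_add.
Proof. by rewrite /galg_mul /galg_add -!lock; exact: mulrDl. Qed.
Lemma galg_mulDr : right_distributive galg_mul galg_add.
Proof. by rewrite /galg_mul /galg_add -!lock; exact: mulrDr. Qed.
Lemma galg_one_neq0 : galg_one != galg_zero.
Proof. by rewrite /galg_one /galg_zero -!lock; exact: oner_neq0. Qed.
HB.instance Definition _ := GRing.Zmodule_isNzRing.Build galg
  galg_mulA galg_mul1 galg_mulr1 galg_mulDl galg_mulDr galg_one_neq0.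

Lemma galg_scaleA k l u : galg_scale k (galg_scale l u) = galg_scale (k * l) u.
Proof. by rewrite /galg_scale -lock; exact: scalerA. Qed.
Lemma galg_scale1 : left_id 1 galg_scale.
Proof. by rewrite /galg_scale -lock; exact: scale1r. Qed.
Lemma galg_scaleDr : right_distributive galg_scale galg_add.
Proof. by rewrite /galg_scale /galg_add -!lock; exact: scalerDr. Qed.
Lemma galg_scaleDl u :
  {morph galg_scale^~ u : k l / k + l >-> galg_add k l}.
Proof. by move=> k l; rewrite /galg_scale /galg_add -!lock; exact: scalerDl. Qed.
HB.instance Definition _ := GRing.Zmodule_isLmodule.Build R galg
  galg_scaleA galg_scale1 galg_scaleDr galg_scaleDl.

Lemma galg_scaleAl k u v : galg_scale k (galg_mul u v) = galg_mul (galg_scale k u) v.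
Proof. by rewrite /galg_scale /galg_mul -!lock; exact: scalerAl. Qed.
Lemma galg_scaleAr k u v : galg_scale k (galg_mul u v) = galg_mul u (galg_scale k v).
Proof. by rewrite /galg_scale /galg_mul -!lock; exact: scalerAr. Qed.
HB.instance Definition _ := GRing.LSemiModule_isLSemiAlgebra.Build R galg
  galg_scaleAl.
HB.instance Definition _ := GRing.LSemiAlgebra_isSemiAlgebra.Build R galg
  galg_scaleAr.

Lemma gdelta1 : gdelta 1%g = 1.
Proof. by rewrite /gdelta -lock -[RHS]/galg_one /galg_one -lock. Qed.
Lemma gdeltaM g h : gdelta (g * h)%g = gdelta g * gdelta h.
Proof.
rewrite /gdelta -lock -[RHS]/(galg_mul _ _) /galg_mul -lock.
by rewrite [RHS]rgalg_MU mulr1.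
Qed.

Lemma galg_ind (P : galg -> Prop) : P 0 ->
  (forall k g u, P u -> P (k *: gdelta g + u)) -> forall u, P u.
Proof.
rewrite -[0]/galg_zero /galg_zero -lock => P0 PD u.
rewrite [u]monalgE; elim: (msupp u : seq G) => [|g r IH].
  by rewrite big_nil.
rewrite big_cons; have := PD u@_g g _ IH.
rewrite -[_ + _]/(galg_add _ _) -[_ *: _]/(galg_scale _ _).
by rewrite /galg_add /galg_scale /gdelta -!lock [_ *: _]rgalg_scaleU mulr1.
Qed.

Section Lift.
Variables (A : algType R) (f : G -> A).

Definition galg_lift : galg -> A := locked (@rgalg_lift R G A f).

Lemma galg_lift_delta g : galg_lift (gdelta g) = f g.
Proof. by rewrite /galg_lift /gdelta -!lock rgalg_liftU scale1r. Qed.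

Lemma galg_lift_linear : linear galg_lift.
Proof.
move=> k u v; rewrite -[_ + _ in LHS]/(galg_add _ _) -[_ *: _ in LHS]/(galg_scale _ _).
by rewrite /galg_lift /galg_add /galg_scale -!lock rgalg_lift_linear.
Qed.
HB.instance Definition _ := GRing.isLinear.Build R galg A *:%R galg_lift
  galg_lift_linear.

Hypothesis f1 : f 1%g = 1.
Hypothesis fM : {morph f : g h / (g * h)%g >-> g * h}.

Lemma galg_lift1 : galg_lift 1 = 1.
Proof. by rewrite -gdelta1 galg_lift_delta. Qed.

Lemma galg_liftM : {morph galg_lift : u v / u * v}.
Proof.
have lift0 : galg_lift 0 = 0 by exact: linear0.
elim/galg_ind=> [v|k g u IH v]; first by rewrite mul0r lift0 mul0r.
rewrite mulrDl galg_lift_linear mulrDl -IH -!scalerAl galg_lift_linear.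
congr (_ *: _ + _).
elim/galg_ind: v {IH} => [|l h v IHv]; first by rewrite mulr0 lift0 mulr0.
rewrite mulrDr -scalerAr -gdeltaM !galg_lift_linear mulrDr IHv.
by rewrite !galg_lift_delta fM scalerAr.
Qed.

End Lift.
End GroupAlgebra.

Section IdealGen.
Variables (R : comNzRingType) (A : algType R) (X : A -> Prop).

(* Finite sums of the u z v with z in X; such sums are stable under R because
   k (u z v) = (k u) z v. *)
Inductive ideal_gen : A -> Prop :=
| ideal_gen0 : ideal_gen 0
| ideal_genD u v : ideal_gen u -> ideal_gen v -> ideal_gen (u + v)
| ideal_gen_mul u z v : X z -> ideal_gen (u * z * v).

Lemma ideal_gen_mem z : X z -> ideal_gen z.
Proof. by move=> /(ideal_gen_mul 1 1); rewrite mul1r mulr1. Qed.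

Lemma ideal_genMl w u : ideal_gen u -> ideal_gen (w * u).
Proof.
elim=> [|u1 u2 _ IH1 _ IH2|u1 z v Xz]; rewrite ?mulr0 ?mulrDr ?mulrA.
- exact: ideal_gen0.
- exact: ideal_genD.
- exact: ideal_gen_mul.
Qed.

Lemma ideal_genMr w u : ideal_gen u -> ideal_gen (u * w).
Proof.
elim=> [|u1 u2 _ IH1 _ IH2|u1 z v Xz]; rewrite ?mul0r ?mulrDl.
- exact: ideal_gen0.
- exact: ideal_genD.
- by rewrite -mulrA; exact: ideal_gen_mul.
Qed.

Lemma ideal_genN u : ideal_gen u -> ideal_gen (- u).
Proof. by rewrite -mulN1r; exact: ideal_genMl. Qed.

Section Kernel.
Variables (B : algType R) (f : A -> B).
Hypothesis flin : linear f.
Hypothesis fmor : monoid_morphism f.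
Hypothesis fX : forall z, X z -> f z = 0.

Lemma ideal_gen_ker u : ideal_gen u -> f u = 0.
Proof.
elim=> [|u1 u2 _ IH1 _ IH2|u1 z v Xz]; first by have := flin (-1) 0 0; rewrite scaler0 addr0 scaleN1r addNr.
- by rewrite -[u1]scale1r flin IH1 IH2 scaler0 addr0.
- by rewrite !fmor.2 (fX Xz) mulr0 mul0r.
Qed.

Lemma ideal_gen_proper : ~ ideal_gen 1.
Proof. by move=> /ideal_gen_ker; rewrite fmor.1 => /eqP; rewrite oner_eq0. Qed.

End Kernel.
End IdealGen.

(* In the library every algType is non-trivial, so only sets that generate a
   proper ideal can be quotiented by. *)
Structure proper_gens (R : comNzRingType) (A : algType R) := ProperGens {
  gens :> A -> Prop;
  gens_proper : ~ ideal_gen gens 1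
}.

Section AlgebraQuotient.
Variables (R : comNzRingType) (A : algType R) (X : proper_gens A).
Local Notation ideal_gen := (@ideal_gen R A X).

Definition ideal_pred : {pred A} := [pred u | `[< ideal_gen u >]].

Lemma ideal_pred_closed : zmod_closed ideal_pred.
Proof.
split; first exact/asboolP/ideal_gen0.
move=> u v /asboolP hu /asboolP hv; apply/asboolP.
exact/ideal_genD/ideal_genN.
Qed.
HB.instance Definition _ := GRing.isZmodClosed.Build A ideal_pred
  ideal_pred_closed.

Definition aquo := Quotient.quot ideal_pred.
HB.instance Definition _ := GRing.Zmodule.on aquo.

Definition aproj : A -> aquo := locked (fun u => \pi_aquo u).

Lemma aprojE u : aproj u = \pi_aquo u.
Proof. by rewrite /aproj -lock. Qed.

Lemma aprojP u v : aproj u = aproj v <-> ideal_gen (u - v).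
Proof.
rewrite !aprojE; split=> [/eqP|h]; first by rewrite piE => /asboolP.
by apply/eqP; rewrite piE; apply/asboolP.
Qed.

Lemma aproj_repr q : aproj (repr q) = q.
Proof. by rewrite aprojE reprK. Qed.

Lemma repr_aproj u : ideal_gen (repr (aproj u) - u).
Proof. by apply/aprojP; rewrite aproj_repr. Qed.

Lemma aproj_surj (P : aquo -> Prop) : (forall u, P (aproj u)) -> forall q, P q.
Proof. by move=> h q; rewrite -(aproj_repr q). Qed.

Lemma aprojB : {morph aproj : u v / u - v}.
Proof. by move=> u v; rewrite !aprojE !piE. Qed.

Definition aquo_mul : aquo -> aquo -> aquo :=
  locked (fun p q => aproj (repr p * repr q)).
Definition aquo_scale : R -> aquo -> aquo :=
  locked (fun k q => aproj (k *: repr q)).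

Lemma aquo_mulE u v : aquo_mul (aproj u) (aproj v) = aproj (u * v).
Proof.
rewrite /aquo_mul -lock; apply/aprojP.
rewrite -[X in X - _](subrK (u * repr (aproj v))) -addrA -mulrBl -mulrBr.
apply: ideal_genD; first exact/ideal_genMr/repr_aproj.
exact/ideal_genMl/repr_aproj.
Qed.

Lemma aquo_scaleE k u : aquo_scale k (aproj u) = aproj (k *: u).
Proof.
rewrite /aquo_scale -lock; apply/aprojP; rewrite -scalerBr -[_ - u]mul1r scalerAl.
exact/ideal_genMl/repr_aproj.
Qed.

Lemma aprojD : {morph aproj : u v / u + v}.
Proof. by move=> u v; rewrite !aprojE !piE. Qed.

Lemma aquo_mulA : associative aquo_mul.
Proof.
elim/aproj_surj=> u; elim/aproj_surj=> v; elim/aproj_surj=> w.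
by rewrite !aquo_mulE mulrA.
Qed.
Lemma aquo_mul1 : left_id (aproj 1) aquo_mul.
Proof. by elim/aproj_surj=> u; rewrite aquo_mulE mul1r. Qed.
Lemma aquo_mulr1 : right_id (aproj 1) aquo_mul.
Proof. by elim/aproj_surj=> u; rewrite aquo_mulE mulr1. Qed.
Lemma aquo_mulDl : left_distributive aquo_mul +%R.
Proof.
elim/aproj_surj=> u; elim/aproj_surj=> v; elim/aproj_surj=> w.
by rewrite -aprojD !aquo_mulE mulrDl aprojD.
Qed.
Lemma aquo_mulDr : right_distributive aquo_mul +%R.
Proof.
elim/aproj_surj=> u; elim/aproj_surj=> v; elim/aproj_surj=> w.
by rewrite -aprojD !aquo_mulE mulrDr aprojD.
Qed.
Lemma aquo_one_neq0 : aproj 1 != 0.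
Proof.
apply/eqP; rewrite -[0](subrr (aproj 0)) -aprojB subr0 => /aprojP.
by rewrite subr0; exact: gens_proper.
Qed.
HB.instance Definition _ := GRing.Zmodule_isNzRing.Build aquo
  aquo_mulA aquo_mul1 aquo_mulr1 aquo_mulDl aquo_mulDr aquo_one_neq0.

Lemma aprojM : {morph aproj : u v / u * v}.
Proof. by move=> u v; rewrite -aquo_mulE. Qed.

Lemma aquo_scaleA k l q : aquo_scale k (aquo_scale l q) = aquo_scale (k * l) q.
Proof. by elim/aproj_surj: q => u; rewrite !aquo_scaleE scalerA. Qed.
Lemma aquo_scale1 : left_id 1 aquo_scale.
Proof. by elim/aproj_surj=> u; rewrite aquo_scaleE scale1r. Qed.
Lemma aquo_scaleDr : right_distributive aquo_scale +%R.
Proof.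
move=> k; elim/aproj_surj=> u; elim/aproj_surj=> v.
by rewrite -aprojD !aquo_scaleE scalerDr aprojD.
Qed.
Lemma aquo_scaleDl q : {morph aquo_scale^~ q : k l / k + l}.
Proof.
by move=> k l; elim/aproj_surj: q => u; rewrite !aquo_scaleE scalerDl aprojD.
Qed.
HB.instance Definition _ := GRing.Zmodule_isLmodule.Build R aquo
  aquo_scaleA aquo_scale1 aquo_scaleDr aquo_scaleDl.

Lemma aprojZ k u : aproj (k *: u) = k *: aproj u.
Proof. by rewrite -aquo_scaleE. Qed.

Lemma aquo_scaleAl k (p q : aquo) : k *: (p * q) = (k *: p) * q.
Proof.
elim/aproj_surj: p => u; elim/aproj_surj: q => v.
by rewrite -aprojM -!aprojZ -aprojM scalerAl.
Qed.
Lemma aquo_scaleAr k (p q : aquo) : k *: (p * q) = p * (k *: q).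
Proof.
elim/aproj_surj: p => u; elim/aproj_surj: q => v.
by rewrite -aprojM -!aprojZ -aprojM scalerAr.
Qed.
HB.instance Definition _ := GRing.LSemiModule_isLSemiAlgebra.Build R aquo
  aquo_scaleAl.
HB.instance Definition _ := GRing.LSemiAlgebra_isSemiAlgebra.Build R aquo
  aquo_scaleAr.

Lemma aproj_linear : linear aproj.
Proof. by move=> k u v; rewrite aprojD aprojZ. Qed.
HB.instance Definition _ := GRing.isLinear.Build R A aquo *:%R aproj aproj_linear.

Lemma aproj_monoid : monoid_morphism aproj.
Proof. by split=> // u v; exact: aprojM. Qed.
HB.instance Definition _ := GRing.isMonoidMorphism.Build A aquo aproj aproj_monoid.

Lemma aproj_eq0 z : X z -> aproj z = 0.
Proof.
by move=> Xz; rewrite -(linear0 aproj); apply/aprojP; rewrite subr0; exact: ideal_gen_mem.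
Qed.

Section Lift.
Variables (B : algType R) (f : A -> B).

Definition aquo_lift (q : aquo) : B := f (repr q).

Hypothesis flin : linear f.
Hypothesis fmor : monoid_morphism f.
Hypothesis fX : forall z, X z -> f z = 0.

Lemma aquo_liftE u : aquo_lift (aproj u) = f u.
Proof.
apply/eqP; rewrite -subr_eq0 /aquo_lift addrC -scaleN1r -flin scaleN1r addrC.
apply/eqP.
exact: (ideal_gen_ker flin fmor fX (repr_aproj u)).
Qed.

Lemma aquo_lift_linear : linear aquo_lift.
Proof.
move=> k; elim/aproj_surj=> u; elim/aproj_surj=> v.
by rewrite -linearP !aquo_liftE flin.
Qed.

Lemma aquo_lift_monoid : monoid_morphism aquo_lift.
Proof.
split; first by rewrite -[LHS]/(aquo_lift (aproj 1)) aquo_liftE fmor.1.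
elim/aproj_surj=> u; elim/aproj_surj=> v.
by rewrite -aprojM !aquo_liftE fmor.2.
Qed.

End Lift.
End AlgebraQuotient.

(* The algebras are defined over an arbitrary commutative ring with three
   elements a, b, c; the inverse of b only serves to see, via the character
   s_i |-> b, that the ideals are proper. *)
Record params (R : comUnitRingType) := Params {
  pa : R; pb : R; pc : R; pb_unit : pb \is a GRing.unit
}.

Definition px (R : comUnitRingType) (p : params R) : R := pb p + pc p.
Definition py (R : comUnitRingType) (p : params R) : R := pb p * pc p.

Section Character.
Variables (R : comUnitRingType) (p : params R) (n : nat).

Definition brchar_word : seq ('I_n.-1 * bool) -> R :=
  foldr (fun l r => (if l.2 then (pb p)^-1 else pb p) * r) 1.

Definition brchar (g : braid n) : R := brchar_word (repr g).

Lemma brchar_word_cat u v :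
  brchar_word (u ++ v) = brchar_word u * brchar_word v.
Proof. by elim: u => [|l u IH] /=; rewrite ?mul1r // IH mulrA. Qed.

Lemma brchar_word_eq u v :
  word_eq (@braid_rel n) u v -> brchar_word u = brchar_word v.
Proof.
have ub := pb_unit p.
elim=> {u v} [//|u v _ -> //|u v w _ -> _ -> //|u v i e|u v l r h].
  by rewrite !brchar_word_cat; case: e => /=; rewrite ?mulKr ?mulVKr.
by rewrite !brchar_word_cat; case: h.
Qed.

Lemma brchar_pword u : brchar (pword _ u) = brchar_word u.
Proof. by apply: brchar_word_eq; apply/pwordP; exact: pword_repr. Qed.

Lemma brchar1 : brchar 1%g = 1.
Proof. exact: (brchar_pword [::]). Qed.

Lemma brcharM : {morph brchar : g h / (g * h)%g >-> g * h}.
Proof.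
move=> g h; rewrite -(pword_repr g) -(pword_repr h) -pwordM.
by rewrite !brchar_pword brchar_word_cat.
Qed.

Lemma brchar_artin i : brchar (artin i) = pb p.
Proof. by rewrite brchar_pword /= mulr1. Qed.

Lemma brcharV g : brchar g * brchar g^-1%g = 1.
Proof. by rewrite -brcharM mulgV brchar1. Qed.

Definition galg_char : galg R (braid n) -> R^o :=
  @galg_lift R (braid n) R^o brchar.

Lemma galg_char_monoid : monoid_morphism galg_char.
Proof.
split.
  exact: (@galg_lift1 R (braid n) R^o brchar brchar1).
exact: (@galg_liftM R (braid n) R^o brchar brcharM).
Qed.

Lemma galg_char_linear : linear galg_char.
Proof. exact: galg_lift_linear. Qed.

Lemma galg_charE g : galg_char (gdelta _ g) = brchar g.
Proof. exact: galg_lift_delta. Qed.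

Lemma galg_char_sub i (k : R) :
  galg_char (gdelta _ (artin i) - k%:A) = pb p - k.
Proof.
rewrite addrC -scaleNr galg_char_linear galg_char_monoid.1 galg_charE.
by rewrite brchar_artin [_ *: _]mulr1 addrC.
Qed.
End Character.

Section Tower.
Variables (R : comUnitRingType) (p : params R) (n : nat).
Local Notation RB := (galg R (braid n)).

Definition cubic_rel (z : RB) : Prop :=
  exists i : 'I_n.-1, let s := gdelta R (artin i) in
    z = (s - (pa p)%:A) * (s - (pb p)%:A) * (s - (pc p)%:A).

Lemma cubic_char z : cubic_rel z -> galg_char p z = 0.
Proof.
move=> [i ->]; rewrite !(@galg_char_monoid R p n).2.
by rewrite !galg_char_sub subrr mulr0 mul0r.
Qed.

Definition cubic_gens : proper_gens RB :=
  ProperGens (ideal_gen_proper (@galg_char_linear R p n) (@galg_char_monoid R p n)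
    cubic_char).

Definition cubicH := aquo cubic_gens.
HB.instance Definition _ := GRing.Algebra.on cubicH.

Definition cubicH_br (g : braid n) : cubicH := aproj cubic_gens (gdelta _ g).

Definition relR (s t : braid n) : cubicH :=
  - py p *: cubicH_br (s * t^-1 * s)%g
  + py p ^+ 2 *: cubicH_br (t^-1 * s * t^-1)%g
  - cubicH_br (s * t * s)%g
  - (px p * py p ^+ 2) *: cubicH_br (t ^- 2)%g
  + px p *: cubicH_br (s ^+ 2)%g
  + py p ^+ 3 *: cubicH_br (t^-1 * s^-1 * t^-1)%g.

Definition bmw_rel (z : cubicH) : Prop :=
  exists i j : 'I_n.-1, j = i.+1 :> nat /\ z = relR (artin i) (artin j).

Definition cubicH_char : cubicH -> R^o := aquo_lift (@galg_char R p n).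

Lemma cubicH_char_linear : linear cubicH_char.
Proof.
exact: (@aquo_lift_linear _ _ cubic_gens _ _ (@galg_char_linear R p n) (@galg_char_monoid R p n) cubic_char).
Qed.

Lemma cubicH_char_monoid : monoid_morphism cubicH_char.
Proof.
exact: (@aquo_lift_monoid _ _ cubic_gens _ _ (@galg_char_linear R p n) (@galg_char_monoid R p n) cubic_char).
Qed.

Lemma cubicH_charE g : cubicH_char (cubicH_br g) = brchar p g.
Proof.
rewrite /cubicH_char aquo_liftE ?galg_charE //.
- exact: galg_char_linear.
- exact: galg_char_monoid.
- exact: cubic_char.
Qed.

Lemma relR_char0 (K : comNzRingType) (b c bi : K) : b * bi = 1 ->
  - (b * c) * (b * (bi * b)) + (b * c) ^+ 2 * (bi * (b * bi))
  - b * (b * b) - ((b + c) * (b * c) ^+ 2) * (bi * bi)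
  + (b + c) * (b * b) + (b * c) ^+ 3 * (bi * (bi * bi)) = 0.
Proof.
move=> h.
suff -> : - (b * c) * (b * (bi * b)) + (b * c) ^+ 2 * (bi * (b * bi))
  - b * (b * b) - ((b + c) * (b * c) ^+ 2) * (bi * bi)
  + (b + c) * (b * b) + (b * c) ^+ 3 * (bi * (bi * bi)) =
  - (b * b * c) * (b * bi) + c * c * b * (b * bi) ^+ 2 - b * (b * b)
  - (b + c) * c ^+ 2 * (b * bi) ^+ 2 + (b + c) * (b * b)
  + c ^+ 3 * (b * bi) ^+ 3.
  by rewrite h; ring.
by ring.
Qed.

Lemma bmw_char z : bmw_rel z -> cubicH_char z = 0.
Proof.
move=> [i [j [_ ->]]]; rewrite /relR.
pose f : {linear cubicH -> R^o} :=
  HB.pack cubicH_char (GRing.isLinear.Build _ _ _ _ _ cubicH_char_linear).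
rewrite -[cubicH_char _]/(f _) !(linearD, linearN, linearZ) /= !linearN /= !cubicH_charE.
have ub := pb_unit p.
have EV (k : 'I_n.-1) : brchar p (artin k)^-1%g = (pb p)^-1.
  by apply: (mulrI ub); rewrite -{1}(brchar_artin p k) brcharV divrr.
rewrite !expgS !expg0 !mulg1 !invgM.
rewrite -!mulgA !brcharM !EV !brchar_artin.
exact: (relR_char0 (pc p) (divrr ub)).
Qed.

Definition bmw_gens : proper_gens cubicH :=
  ProperGens (ideal_gen_proper cubicH_char_linear cubicH_char_monoid bmw_char).

Definition tBMW := aquo bmw_gens.
HB.instance Definition _ := GRing.Algebra.on tBMW.

Definition tBMW_br (g : braid n) : tBMW := aproj bmw_gens (cubicH_br g).

Definition hecke_rel (z : RB) : Prop :=
  exists i : 'I_n.-1, let s := gdelta R (artin i) in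
    z = (s - (pb p)%:A) * (s - (pc p)%:A).

Lemma hecke_char z : hecke_rel z -> galg_char p z = 0.
Proof.
move=> [i ->]; rewrite !(@galg_char_monoid R p n).2.
by rewrite !galg_char_sub subrr mul0r.
Qed.

Definition hecke_gens : proper_gens RB :=
  ProperGens (ideal_gen_proper (@galg_char_linear R p n) (@galg_char_monoid R p n)
    hecke_char).

Definition hecke := aquo hecke_gens.
HB.instance Definition _ := GRing.Algebra.on hecke.

Definition hecke_br (g : braid n) : hecke := aproj hecke_gens (gdelta _ g).

End Tower.

Lemma lin6 (R : comNzRingType) (A B : lmodType R) (f : {linear A -> B})
  (k1 k2 k3 k4 k5 : R) (u1 u2 u3 u4 u5 u6 : A) :
  f (k1 *: u1 + k2 *: u2 - u3 - k3 *: u4 + k4 *: u5 + k5 *: u6) =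
  k1 *: f u1 + k2 *: f u2 - f u3 - k3 *: f u4 + k4 *: f u5 + k5 *: f u6.
Proof. by rewrite !(linearD, linearN, linearZ) /= !linearN. Qed.

Lemma quad_inv (R : comNzRingType) (A : algType R) (b c : R) (s s' : A) :
  (s - b%:A) * (s - c%:A) = 0 -> s * s' = 1 ->
  (b * c) *: s' = (b + c)%:A - s.
Proof.
move=> h e; have : (s - b%:A) * (s - c%:A) * s' = 0 by rewrite h mul0r.
have -> : (s - b%:A) * (s - c%:A) * s' = s - (b + c)%:A + (b * c) *: s'.
  rewrite -mulrA [(s - c%:A) * s']mulrBl e mulr_algl mulrBl !mulrBr !mulr1.
  rewrite -scalerAr e !mulr_algl scalerA scalerDl opprB opprD.
  by rewrite -!addrA; congr (_ + _); rewrite addrCA; congr (_ + _); rewrite addrC.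
by move=> /eqP; rewrite addrC addr_eq0 opprB => /eqP.
Qed.

Lemma quad_relR (R : comNzRingType) (A : algType R) (x y : R) (s s' t t' : A) :
  y *: s' = x%:A - s -> y *: t' = x%:A - t ->
  - y *: (s * (t' * s)) + y ^+ 2 *: (t' * (s * t')) - s * (t * s)
  - (x * y ^+ 2) *: (t' * t') + x *: (s * s) + y ^+ 3 *: (t' * (s' * t')) = 0.
Proof.
move=> hs ht.
have -> : - y *: (s * (t' * s)) = - (s * ((y *: t') * s)).
  by rewrite scaleNr -scalerAl -scalerAr.
have -> : y ^+ 2 *: (t' * (s * t')) = (y *: t') * (s * (y *: t')).
  by rewrite -!scalerAr -scalerAl scalerA expr2.
have -> : (x * y ^+ 2) *: (t' * t') = x *: ((y *: t') * (y *: t')).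
  by rewrite -!scalerAr -scalerAl !scalerA mulrA.
have -> : y ^+ 3 *: (t' * (s' * t')) = (y *: t') * ((y *: s') * (y *: t')).
  by rewrite -!scalerAr -!scalerAl -scalerAr !scalerA exprS expr2 mulrA.
set v := y *: t' in ht *; rewrite hs.
have -> : s * (t * s) = x *: (s * s) - s * (v * s).
  have -> : t = x%:A - v by rewrite ht opprB addrC subrK.
  by rewrite mulrBl mulr_algl mulrBr -scalerAr.
have -> : v * ((x%:A - s) * v) = x *: (v * v) - v * (s * v).
  by rewrite mulrBl mulr_algl mulrBr -scalerAr.
set A1 := s * (v * s); set A2 := v * (s * v).
set A3 := x *: (s * s); set A4 := x *: (v * v).
have -> : - A1 + A2 - (A3 - A1) = A2 - A3.
  by rewrite opprB addrA [- A1 + A2]addrC subrK.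
by rewrite [_ + A3]addrAC subrK addrA subrK subrr.
Qed.

Section Morphisms.
Variables (R : comUnitRingType) (p : params R).

Lemma galg_lift_gens (A : algType R) n (f : braid n -> A) (k : R) (g : braid n) :
  f 1%g = 1 -> galg_lift f (gdelta R g - k%:A) = f g - k%:A.
Proof.
by move=> f1; rewrite linearB linearZ /= galg_lift_delta galg_lift1.
Qed.

Lemma galg_lift_monoid (A : algType R) n (f : braid n -> A) :
  f 1%g = 1 -> {morph f : g h / (g * h)%g >-> g * h} ->
  monoid_morphism (galg_lift f).
Proof. by move=> f1 fM; split; [exact: galg_lift1|exact: galg_liftM]. Qed.

Lemma cubicH_br1 n : cubicH_br p (1%g : braid n) = 1.
Proof. by rewrite /cubicH_br gdelta1 rmorph1. Qed.

Lemma cubicH_brM n : {morph @cubicH_br R p n : g h / (g * h)%g >-> g * h}.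
Proof. by move=> g h; rewrite /cubicH_br gdeltaM rmorphM. Qed.

Lemma tBMW_br1 n : tBMW_br p (1%g : braid n) = 1.
Proof. by rewrite /tBMW_br cubicH_br1 rmorph1. Qed.

Lemma tBMW_brM n : {morph @tBMW_br R p n : g h / (g * h)%g >-> g * h}.
Proof. by move=> g h; rewrite /tBMW_br cubicH_brM rmorphM. Qed.

Lemma hecke_br1 n : hecke_br p (1%g : braid n) = 1.
Proof. by rewrite /hecke_br gdelta1 rmorph1. Qed.

Lemma hecke_brM n : {morph @hecke_br R p n : g h / (g * h)%g >-> g * h}.
Proof. by move=> g h; rewrite /hecke_br gdeltaM rmorphM. Qed.

Section Incl.
Variable n : nat.

Let brincl (g : braid n) : cubicH p n.+1 := cubicH_br p (braid_incl g).

Let brincl1 : brincl 1%g = 1.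
Proof. by rewrite /brincl braid_incl1 cubicH_br1. Qed.

Let brinclM : {morph brincl : g h / (g * h)%g >-> g * h}.
Proof. by move=> g h; rewrite /brincl braid_inclM cubicH_brM. Qed.

Let brincl_lin : linear (galg_lift brincl).
Proof. exact: galg_lift_linear. Qed.

Let brincl_mon : monoid_morphism (galg_lift brincl).
Proof. exact: galg_lift_monoid. Qed.

Let brincl_rel z : cubic_gens p n z -> galg_lift brincl z = 0.
Proof.
move=> [i ->]; rewrite !brincl_mon.2 !galg_lift_gens //.
rewrite /brincl braid_incl_artin.
set s := artin _.
have E k : cubicH_br p s - k%:A = aproj (cubic_gens p n.+1) (gdelta R s - k%:A).
  by rewrite rmorphB /= rmorph_alg.
rewrite !E -!rmorphM; apply: aproj_eq0.
by exists (@widen_ord n.-1 n (leq_pred n) i).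
Qed.

Definition cubicH_incl : cubicH p n -> cubicH p n.+1 :=
  aquo_lift (galg_lift (fun g => cubicH_br p (braid_incl g))).

Lemma cubicH_incl_linear : linear cubicH_incl.
Proof. exact: (@aquo_lift_linear _ _ (cubic_gens p n) _ _ brincl_lin brincl_mon brincl_rel). Qed.
HB.instance Definition _ := GRing.isLinear.Build R (cubicH p n) (cubicH p n.+1)
  *:%R cubicH_incl cubicH_incl_linear.

Lemma cubicH_incl_monoid : monoid_morphism cubicH_incl.
Proof. exact: (@aquo_lift_monoid _ _ (cubic_gens p n) _ _ brincl_lin brincl_mon brincl_rel). Qed.
HB.instance Definition _ := GRing.isMonoidMorphism.Build (cubicH p n)
  (cubicH p n.+1) cubicH_incl cubicH_incl_monoid.

Lemma cubicH_inclE g :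
  cubicH_incl (cubicH_br p g) = cubicH_br p (braid_incl g).
Proof.
rewrite /cubicH_incl.
rewrite (@aquo_liftE _ _ (cubic_gens p n) _ _ brincl_lin brincl_mon brincl_rel).
exact: galg_lift_delta.
Qed.

Lemma cubicH_incl_relR s t :
  cubicH_incl (relR p s t) = relR p (braid_incl s) (braid_incl t).
Proof.
rewrite /relR lin6 /= !cubicH_inclE.
by rewrite !expgS !expg0 !mulg1 !(braid_inclM, braid_inclV).
Qed.

Definition tBMW_incl : tBMW p n -> tBMW p n.+1 :=
  aquo_lift (fun z => aproj (bmw_gens p n.+1) (cubicH_incl z)).

Let incl (z : cubicH p n) : tBMW p n.+1 :=
  aproj (bmw_gens p n.+1) (cubicH_incl z).

Let incl_lin : linear incl.
Proof. by move=> k z w; rewrite /incl !linearP. Qed.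

Let incl_mon : monoid_morphism incl.
Proof. by split=> [|z w]; rewrite /incl ?rmorph1 ?rmorphM. Qed.

Let incl_rel z : bmw_gens p n z -> incl z = 0.
Proof.
move=> [i [j [hij ->]]]; rewrite /incl cubicH_incl_relR !braid_incl_artin.
apply: aproj_eq0.
by exists (@widen_ord n.-1 n (leq_pred n) i), (@widen_ord n.-1 n (leq_pred n) j).
Qed.

Lemma tBMW_incl_linear : linear tBMW_incl.
Proof. exact: (@aquo_lift_linear _ _ (bmw_gens p n) _ _ incl_lin incl_mon incl_rel). Qed.
HB.instance Definition _ := GRing.isLinear.Build R (tBMW p n) (tBMW p n.+1)
  *:%R tBMW_incl tBMW_incl_linear.

Lemma tBMW_incl_monoid : monoid_morphism tBMW_incl.
Proof. exact: (@aquo_lift_monoid _ _ (bmw_gens p n) _ _ incl_lin incl_mon incl_rel). Qed.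
HB.instance Definition _ := GRing.isMonoidMorphism.Build (tBMW p n)
  (tBMW p n.+1) tBMW_incl tBMW_incl_monoid.

Lemma tBMW_inclE g : tBMW_incl (tBMW_br p g) = tBMW_br p (braid_incl g).
Proof.
rewrite /tBMW_incl.
rewrite (@aquo_liftE _ _ (bmw_gens p n) _ _ incl_lin incl_mon incl_rel).
by rewrite /incl cubicH_inclE.
Qed.

End Incl.

Section ToHecke.
Variable n : nat.

Let brh_lin : linear (galg_lift (@hecke_br R p n)).
Proof. exact: galg_lift_linear. Qed.

Let brh_mon : monoid_morphism (galg_lift (@hecke_br R p n)).
Proof. exact: galg_lift_monoid (hecke_br1 n) (@hecke_brM n). Qed.

Lemma hecke_quad (i : 'I_n.-1) :
  (hecke_br p (artin i) - (pb p)%:A) * (hecke_br p (artin i) - (pc p)%:A) = 0.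
Proof.
set s := artin i.
have E k : hecke_br p s - k%:A = aproj (hecke_gens p n) (gdelta R s - k%:A).
  by rewrite rmorphB /= rmorph_alg.
by rewrite !E -rmorphM; apply: aproj_eq0; exists i.
Qed.

Let brh_rel z : cubic_gens p n z -> galg_lift (@hecke_br R p n) z = 0.
Proof.
move=> [i ->]; rewrite !brh_mon.2 !galg_lift_gens ?hecke_br1 //.
by rewrite -mulrA hecke_quad mulr0.
Qed.

Definition cubicH_hecke : cubicH p n -> hecke p n :=
  aquo_lift (galg_lift (@hecke_br R p n)).

Lemma cubicH_hecke_linear : linear cubicH_hecke.
Proof. exact: (@aquo_lift_linear _ _ (cubic_gens p n) _ _ brh_lin brh_mon brh_rel). Qed.
HB.instance Definition _ := GRing.isLinear.Build R (cubicH p n) (hecke p n)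
  *:%R cubicH_hecke cubicH_hecke_linear.

Lemma cubicH_hecke_monoid : monoid_morphism cubicH_hecke.
Proof. exact: (@aquo_lift_monoid _ _ (cubic_gens p n) _ _ brh_lin brh_mon brh_rel). Qed.
HB.instance Definition _ := GRing.isMonoidMorphism.Build (cubicH p n)
  (hecke p n) cubicH_hecke cubicH_hecke_monoid.

Lemma cubicH_heckeE g : cubicH_hecke (cubicH_br p g) = hecke_br p g.
Proof.
rewrite /cubicH_hecke.
rewrite (@aquo_liftE _ _ (cubic_gens p n) _ _ brh_lin brh_mon brh_rel).
exact: galg_lift_delta.
Qed.

Lemma hecke_br_mulV (g : braid n) : hecke_br p g * hecke_br p g^-1%g = 1.
Proof. by rewrite -hecke_brM mulgV hecke_br1. Qed.

(* y s^-1 = x - s in the Hecke algebra *)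
Lemma hecke_inv (i : 'I_n.-1) :
  py p *: hecke_br p (artin i)^-1%g = (px p)%:A - hecke_br p (artin i).
Proof. exact: quad_inv (hecke_quad i) (hecke_br_mulV _). Qed.

Let hecke_relR z : bmw_gens p n z -> cubicH_hecke z = 0.
Proof.
move=> [i [j [_ ->]]]; rewrite /relR lin6 /= !cubicH_heckeE.
rewrite !expgS !expg0 !mulg1 !invgM -!mulgA !hecke_brM.
exact: quad_relR (hecke_inv i) (hecke_inv j).
Qed.

Definition tBMW_hecke : tBMW p n -> hecke p n := aquo_lift cubicH_hecke.

Lemma tBMW_hecke_linear : linear tBMW_hecke.
Proof.
exact: (@aquo_lift_linear _ _ (bmw_gens p n) _ _
  cubicH_hecke_linear cubicH_hecke_monoid hecke_relR).
Qed.
HB.instance Definition _ := GRing.isLinear.Build R (tBMW p n) (hecke p n)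
  *:%R tBMW_hecke tBMW_hecke_linear.

Lemma tBMW_hecke_monoid : monoid_morphism tBMW_hecke.
Proof.
exact: (@aquo_lift_monoid _ _ (bmw_gens p n) _ _
  cubicH_hecke_linear cubicH_hecke_monoid hecke_relR).
Qed.
HB.instance Definition _ := GRing.isMonoidMorphism.Build (tBMW p n)
  (hecke p n) tBMW_hecke tBMW_hecke_monoid.

Lemma tBMW_heckeE z : tBMW_hecke (aproj (bmw_gens p n) z) = cubicH_hecke z.
Proof.
exact: (@aquo_liftE _ _ (bmw_gens p n) _ _
  cubicH_hecke_linear cubicH_hecke_monoid hecke_relR).
Qed.

End ToHecke.

(* t n is the component on tBMW_(n+1); in tBMW_(n+2), artin ord_max is the
   last generator s_(n+1). *)
Definition is_markov_trace (M : lmodType R)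
    (t : forall n, {linear tBMW p n.+1 -> M}) : Prop :=
  (forall n (u v : tBMW p n.+1), t n (u * v) = t n (v * u)) /\
  (forall n (u : tBMW p n.+1), let s := @artin n.+2 ord_max in
     t n.+1 (tBMW_incl u * tBMW_br p s) = t n u /\
     t n.+1 (tBMW_incl u * tBMW_br p s^-1%g) = t n u).

End Morphisms.

(* mpoly and monalg both use the notation p@_m, hence the late import *)
From mathcomp Require Import mpoly.

(* A[1/f], realized inside the field of fractions of A as the set of the z
   such that z f^k lies in A for some k. *)
Module Loc.
Section Localization.
Variables (A : idomainType) (f : A).

Definition loc_pred : {pred {fraction A}} :=
  [pred z | `[< exists k p, z * tofrac (f ^+ k) = tofrac p >]].

Lemma loc_pred_closed : subring_closed loc_pred.
Proof.
split.
- by apply/asboolP; exists 0%N, 1; rewrite expr0 mul1r.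
- move=> z w /asboolP[k [p hz]] /asboolP[l [q hw]]; apply/asboolP.
  exists (k + l)%N, (p * f ^+ l - q * f ^+ k).
  rewrite exprD tofracB !tofracM -hz -hw mulrBl.
  by congr (_ - _); rewrite -!mulrA // [tofrac (f ^+ k) * _]mulrC.
- move=> z w /asboolP[k [p hz]] /asboolP[l [q hw]]; apply/asboolP.
  exists (k + l)%N, (p * q).
  by rewrite exprD !tofracM -hz -hw mulrACA.
Qed.
HB.instance Definition _ := GRing.isSubringClosed.Build {fraction A} loc_pred
  loc_pred_closed.

Definition loc : Type := {z : {fraction A} | z \in loc_pred}.
HB.instance Definition _ := SubChoice.on loc.
Definition mkloc (z : {fraction A}) (hz : z \in loc_pred) : loc := exist _ z hz.
HB.instance Definition _ := [SubChoice_isSubComNzRing of loc by <:].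

Definition loc_unit : {pred loc} := [pred z | `[< exists w : loc, w * z = 1 >]].
Definition loc_inv (z : loc) : loc :=
  if pselect (exists w : loc, w * z = 1) is left h then sval (cid h) else z.

Lemma loc_mulVr : {in loc_unit, left_inverse 1 loc_inv *%R}.
Proof.
by move=> z /asboolP hz; rewrite /loc_inv; case: pselect => // h; case: cid.
Qed.
Lemma loc_unitPl (z w : loc) : w * z = 1 -> z \in loc_unit.
Proof. by move=> h; apply/asboolP; exists w. Qed.
Lemma loc_inv_out : {in [predC loc_unit], loc_inv =1 id}.
Proof.
by move=> z /asboolPn hz; rewrite /loc_inv; case: pselect.
Qed.
HB.instance Definition _ := GRing.ComNzRing_hasMulInverse.Build loc
  loc_mulVr loc_unitPl loc_inv_out.

Lemma loc_integral (z w : loc) : z * w = 0 -> (z == 0) || (w == 0).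
Proof.
move=> /(congr1 val); rewrite rmorphM /= => /eqP.
by rewrite mulf_eq0 -!(inj_eq val_inj).
Qed.
HB.instance Definition _ := GRing.ComUnitRing_isIntegral.Build loc loc_integral.

Lemma locin_subproof (p : A) : tofrac p \in loc_pred.
Proof. by apply/asboolP; exists 0%N, p; rewrite expr0 tofrac1 mulr1. Qed.
Definition locin (p : A) : loc := mkloc (locin_subproof p).

Lemma locin_zmod : zmod_morphism locin.
Proof. by move=> p q; apply: val_inj; rewrite /= tofracB. Qed.
HB.instance Definition _ := GRing.isZmodMorphism.Build A loc locin locin_zmod.
Lemma locin_monoid : monoid_morphism locin.
Proof. by split=> [|p q]; apply: val_inj; rewrite /= ?tofrac1 ?tofracM. Qed.
HB.instance Definition _ := GRing.isMonoidMorphism.Build A loc locin locin_monoid.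

Lemma locin_inj : injective locin.
Proof. by move=> p q /(congr1 val) /= /eqP; rewrite tofrac_eq => /eqP. Qed.

Lemma locP (z : loc) : exists k p, z * locin f ^+ k = locin p.
Proof.
case: z => z hz; case/asboolP: (hz) => k [p h]; exists k, p.
by rewrite -rmorphXn; apply: val_inj.
Qed.

Lemma locin_unit : f != 0 -> locin f \is a GRing.unit.
Proof.
move=> f0; have hz : (tofrac f)^-1 \in loc_pred.
  by apply/asboolP; exists 1%N, 1; rewrite expr1 tofrac1 mulVf // tofrac_eq0.
apply/unitrPr; exists (mkloc hz); apply: val_inj.
by rewrite /= mulfV // tofrac_eq0.
Qed.

Definition loc_scale (p : A) (z : loc) : loc := locin p * z.
Lemma loc_scaleA p q z : loc_scale p (loc_scale q z) = loc_scale (p * q) z.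
Proof. by rewrite /loc_scale rmorphM mulrA. Qed.
Lemma loc_scale1 : left_id 1 loc_scale.
Proof. by move=> z; rewrite /loc_scale rmorph1 mul1r. Qed.
Lemma loc_scaleDr : right_distributive loc_scale +%R.
Proof. by move=> p z w; rewrite /loc_scale mulrDr. Qed.
Lemma loc_scaleDl z : {morph loc_scale^~ z : p q / p + q}.
Proof. by move=> p q; rewrite /loc_scale rmorphD mulrDl. Qed.
HB.instance Definition _ := GRing.Zmodule_isLmodule.Build A loc
  loc_scaleA loc_scale1 loc_scaleDr loc_scaleDl.

Lemma loc_scaleE p (z : loc) : p *: z = locin p * z.
Proof. by []. Qed.

Lemma loc_scaleAl p (z w : loc) : p *: (z * w) = (p *: z) * w.
Proof. by rewrite !loc_scaleE mulrA. Qed.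
HB.instance Definition _ := GRing.LSemiModule_isLSemiAlgebra.Build A loc
  loc_scaleAl.
Lemma loc_scaleAr p (z w : loc) : p *: (z * w) = z * (p *: w).
Proof. by rewrite !loc_scaleE mulrCA. Qed.
HB.instance Definition _ := GRing.LSemiAlgebra_isSemiAlgebra.Build A loc
  loc_scaleAr.

(* The action of A[1/f] on an A-module M on which f acts bijectively:
   (p / f^k) m is the element m' such that f^k m' = p m. *)
Section Action.
Variable M : lmodType A.

Definition loc_act (z : loc) (m : M) : M :=
  xget 0 [set m' | forall k p, z * locin f ^+ k = locin p ->
                     f ^+ k *: m' = p *: m].

Hypothesis fM : bijective (fun m : M => f *: m).

Lemma loc_actX_inj k : injective (fun m : M => f ^+ k *: m).
Proof.
elim: k => [|k IH] m m' /=; first by rewrite !scale1r.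
by rewrite exprS -!scalerA => /(bij_inj fM)/IH.
Qed.

Lemma loc_actX_surj k (m : M) : exists m', f ^+ k *: m' = m.
Proof.
elim: k m => [|k IH] m; first by exists m; rewrite scale1r.
case: fM => g _ gK; case: (IH (g m)) => m' h.
by exists m'; rewrite exprS -scalerA h gK.
Qed.

Lemma loc_actP z m k p : z * locin f ^+ k = locin p ->
  f ^+ k *: loc_act z m = p *: m.
Proof.
rewrite /loc_act; case: xgetP => [m' _ /= h /h //|/= noex].
case: (locP z) => l [q hq]; case: (loc_actX_surj l (q *: m)) => m' hm'.
case: (noex m') => /= k' p' hp'; apply: (@loc_actX_inj l).
rewrite [LHS]scalerA mulrC -[LHS]scalerA hm' !scalerA; congr (_ *: _).
apply: locin_inj; rewrite !rmorphM /= -hq -hp' !rmorphXn.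
by rewrite mulrCA [RHS]mulrCA (mulrC (locin f ^+ _)).
Qed.

Lemma loc_act_unique z m m' k p : z * locin f ^+ k = locin p ->
  f ^+ k *: m' = p *: m -> m' = loc_act z m.
Proof. by move=> h h'; apply: (@loc_actX_inj k); rewrite (loc_actP _ h). Qed.

Lemma loc_act_in p m : loc_act (locin p) m = p *: m.
Proof.
by apply/esym/(@loc_act_unique _ _ _ 0%N p); rewrite ?mulr1 ?scale1r.
Qed.

Lemma loc_act1 m : loc_act 1 m = m.
Proof. by rewrite -(rmorph1 locin) loc_act_in scale1r. Qed.

Lemma loc_actDr z : {morph loc_act z : m m' / m + m'}.
Proof.
move=> m m'; case: (locP z) => k [p h]; apply/esym/(loc_act_unique h).
by rewrite !scalerDr !(loc_actP _ h).
Qed.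

Lemma loc_actDl m : {morph loc_act^~ m : z w / z + w}.
Proof.
move=> z w; case: (locP z) => k [p hp]; case: (locP w) => l [q hq].
apply/esym/(@loc_act_unique _ _ _ (k + l) (p * f ^+ l + q * f ^+ k)).
  rewrite rmorphD !rmorphM /= -hp -hq !rmorphXn exprD mulrDl -!mulrA.
  by congr (_ + _ * _); rewrite mulrC.
rewrite scalerDr scalerDl exprD; congr (_ + _).
  by rewrite [_ * f ^+ l]mulrC -[LHS]scalerA (loc_actP _ hp) scalerA mulrC.
by rewrite -[LHS]scalerA (loc_actP _ hq) scalerA mulrC.
Qed.

Lemma loc_actA z w m : loc_act z (loc_act w m) = loc_act (z * w) m.
Proof.
case: (locP z) => k [p hp]; case: (locP w) => l [q hq].
apply: (@loc_act_unique _ _ _ (k + l) (p * q)).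
  by rewrite rmorphM /= -hp -hq exprD mulrACA.
rewrite exprD [f ^+ k * _]mulrC -[LHS]scalerA (loc_actP _ hp).
by rewrite [LHS]scalerA [f ^+ l * p]mulrC -[LHS]scalerA (loc_actP _ hq) scalerA.
Qed.

End Action.
End Localization.
End Loc.
Export Loc.

Local Notation pol := {mpoly rat[3]}.
Local Notation Xa := ('X_(@Ordinal 3 0 isT) : pol).
Local Notation Xb := ('X_(@Ordinal 3 1 isT) : pol).
Local Notation Xc := ('X_(@Ordinal 3 2 isT) : pol).

(* Q[a, b, c, (abc)^-1] *)
Definition Rabc := loc (Xa * Xb * Xc).
HB.instance Definition _ := GRing.IntegralDomain.on Rabc.

Definition va : Rabc := locin _ Xa.
Definition vb : Rabc := locin _ Xb.
Definition vc : Rabc := locin _ Xc.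
Definition vx : Rabc := vb + vc.
Definition vy : Rabc := vb * vc.

(* Rabc[x^-1] *)
Definition Sabc := loc vx.
HB.instance Definition _ := GRing.IntegralDomain.on Sabc.
HB.instance Definition _ := GRing.Algebra.on Sabc.

Lemma polX_neq0 (i : 'I_3) : ('X_i : pol) != 0.
Proof.
apply/eqP => /(congr1 (mpoly.mcoeff U_(i)%MM)).
by rewrite mcoeffXU eqxx mpoly.mcoeff0 => /eqP; rewrite oner_eq0.
Qed.

Lemma vabc_unit :
  [/\ va \is a GRing.unit, vb \is a GRing.unit & vc \is a GRing.unit].
Proof.
have : va * vb * vc \is a GRing.unit.
  rewrite /va /vb /vc -!rmorphM; apply: locin_unit.
  by rewrite !mulf_neq0 ?polX_neq0.
by rewrite !unitrM -andbA => /and3P[].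
Qed.

Lemma vx_neq0 : vx != 0.
Proof.
rewrite /vx /vb /vc -(rmorphD (locin _)) -(rmorph0 (locin (Xa * Xb * Xc))).
rewrite (inj_eq (@locin_inj _ _)).
apply/eqP => /(congr1 (mpoly.mcoeff U_(@Ordinal 3 1 isT)%MM)).
rewrite mpoly.mcoeffD !mcoeffXU mpoly.mcoeff0 addr0 => /eqP.
by rewrite oner_eq0.
Qed.


Definition abc : params Rabc :=
  Params va vc (let: And3 _ ub _ := vabc_unit in ub).

Definition is_ocneanu_trace (t : forall n, {linear tBMW abc n.+1 -> Sabc}) :
    Prop :=
  [/\ is_markov_trace t,
      forall n, exists f : {linear hecke abc n.+1 -> Sabc},
        forall u : tBMW abc n.+1, t n u = f (tBMW_hecke u)
    & t 0%N 1 = 1].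

(* Main.v *)
(* Put q_i = s_i + y s_i^-1 - x = (s_i - b) (s_i - c) s_i^-1, so that
   s_i q_i = a q_i.  The relation R_i reads s_i q_j s_i = y^2 s_j^-1 q_i s_j^-1
   with j = i + 1, equivalently s_j^2 s_i q_j = y^2 s_i^-1 q_j.  For v on n
   strands, the traces of v s_n q_(n+1) and v s_n^-1 q_(n+1) are both equal to
   (1 + y) t_n(v) - x t_(n+1)(v), since v s_n^(+-1) with one more free strand
   closes to the closure of v with a split unknot; the relation multiplies the
   first by a^2 and the second by y^2.  Hence x t_(n+1)(v) = (1 + y) t_n(v).
   As the algebra on n + 1 strands is the sum A + A s_n A + A s_n^-1 A, with A
   the image of the algebra on n strands, this recursion, which the Ocneanu
   trace satisfies too, determines the trace from t_1(1). *)
Require Import Defs.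
From mathcomp Require Import all_boot all_order all_algebra.

Set Implicit Arguments.
Unset Strict Implicit.
Unset Printing Implicit Defensive.

Import GRing.Theory.
Local Open Scope ring_scope.

(** * Identities between invertible elements under the cubic and braid relations *)

Lemma comm_inv (A : pzRingType) (u t t' : A) :
  t * t' = 1 -> t' * t = 1 -> u * t = t * u -> u * t' = t' * u.
Proof.
move=> tt' t't ut.
by rewrite -[LHS]mul1r -t't -mulrA [t * _]mulrA -ut -mulrA tt' mulr1.
Qed.

Section AlgebraIdentities.
Variables (R : comUnitRingType) (A : algType R).

(** The element q_i of the overview, with a separate argument [s'] for the inverse so that it makes
    sense in any algebra. *)
Definition skein (x y : R) (s s' : A) : A := s + y *: s' - x%:A.

Lemma quad_skein (b c : R) (s s' : A) : s * s' = 1 ->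
  (s - b%:A) * (s - c%:A) * s' = skein (b + c) (b * c) s s'.
Proof.
move=> e; rewrite /skein -mulrA [(s - c%:A) * s']mulrBl e mulr_algl mulrBl.
rewrite !mulrBr !mulr1 -scalerAr e !mulr_algl scalerA scalerDl opprB opprD.
by rewrite (AC (2*2) ((1*3)*(4*2))%AC).
Qed.

Lemma cubic_skein (a b c : R) (s s' : A) : s * s' = 1 ->
  (s - a%:A) * (s - b%:A) * (s - c%:A) = 0 ->
  s * skein (b + c) (b * c) s s' = a *: skein (b + c) (b * c) s s'.
Proof.
move=> e h; apply/eqP; rewrite -subr_eq0 -mulr_algl -mulrBl -(quad_skein _ _ e).
by rewrite !mulrA h mul0r.
Qed.

Variables (a x y : R).
Local Notation p := (skein x y).

(** Multiply the hypothesis by [s'] on the right and collect terms: the cubic relation solved for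
    the inverse square. *)
Lemma cubic_inv_sqr (s s' : A) : s * s' = 1 -> s * p s s' = a *: p s s' ->
  (a * y) *: (s' * s') = s - x%:A - a%:A + (y + a * x) *: s'.
Proof.
move=> e /(congr1 (fun z => z * s')).
have -> : s * p s s' * s' = s + y *: s' - x%:A.
  rewrite /skein mulrBr mulrDr -!scalerAr mulr1 e !mulrBl mulrDl -!scalerAl.
  by rewrite -mulrA e mulr1 mul1r.
have -> : a *: p s s' * s' = a%:A + (a * y) *: (s' * s') - (a * x) *: s'.
  rewrite /skein -scalerAl mulrBl mulrDl mulr_algl -scalerAl e.
  by rewrite scalerBr scalerDr !scalerA.
move=> h; apply: (addrI a%:A); apply: (addIr (- (a * x *: s'))); rewrite -h.
rewrite scalerDl [RHS](AC (1*(3*2)*1) ((2*5*3)*((1*4)*(6*7)))%AC) /=.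
by rewrite !subrr !addr0.
Qed.

(** A regrouping valid for arbitrary elements: the terms between two [t'] and the terms between two
    [s] each assemble into a skein element. *)
Lemma relR_skein (s s' t t' : A) :
  - y *: (s * t' * s) + y ^+ 2 *: (t' * s * t') - s * t * s
  - (x * y ^+ 2) *: (t' * t') + x *: (s * s) + y ^+ 3 *: (t' * s' * t') =
  y ^+ 2 *: (t' * p s s' * t') - s * p t t' * s.
Proof.
rewrite /skein !mulrBr !mulrDr !mulrBl !mulrDl !mulr_algr -!scalerAr -!scalerAl.
rewrite scalerBr scalerDr !scalerA -exprSr [y ^+ 2 * x]mulrC !opprD opprK scaleNr.
by rewrite [LHS](AC 6 ((2*6*4)*(3*1*5))%AC).
Qed.

Section Braid.
Variables (s s' t t' : A).
Hypotheses (ss' : s * s' = 1) (s's : s' * s = 1).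
Hypotheses (tt' : t * t' = 1) (t't : t' * t = 1).
Hypothesis sts : s * (t * s) = t * (s * t).

Let Kss' z : z * s * s' = z. Proof. by rewrite -mulrA ss' mulr1. Qed.
Let Ks's z : z * s' * s = z. Proof. by rewrite -mulrA s's mulr1. Qed.
Let Ktt' z : z * t * t' = z. Proof. by rewrite -mulrA tt' mulr1. Qed.
Let Kt't z : z * t' * t = z. Proof. by rewrite -mulrA t't mulr1. Qed.
Let Ksts z : z * s * t * s = z * t * s * t.
Proof. by rewrite -!mulrA sts. Qed.

(** In these names [V] and [p] give the exponents on the left-hand side, inverse or plain. *)
Lemma braidVpp : t' * s * t = s * t * s'.
Proof. by rewrite -[LHS]Kss' Ksts t't mul1r. Qed.

Lemma braidVVp : t' * s' * t = s * t' * s'.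
Proof. by rewrite -[LHS]Kss' -[t' * s' * t * s]Ktt' -Ksts Ks's t't mul1r. Qed.

Lemma braidVVV : t' * s' * t' = s' * t' * s'.
Proof.
rewrite -[RHS]Ktt' -[s' * t' * s' * t]Kss' -[s' * t' * s' * t * s]Ktt' -Ksts.
by rewrite Ks's Kt't s's mul1r.
Qed.

(** Conjugation by [t' * s'] carries [t] to [s], hence the skein element of [t] to that of [s]. *)
Lemma skein_braidVV : p s s' * (t' * s') = t' * s' * p t t'.
Proof.
rewrite /skein mulrBl mulrDl mulrBr mulrDr mulr_algl mulr_algr.
by rewrite -scalerAl -scalerAr !mulrA -braidVVp -braidVVV.
Qed.

Hypothesis rel : s * p t t' * s = y ^+ 2 *: (t' * p s s' * t').

(** Multiply [rel] by [t * t] on the left and by [s'] on the right, then move the skein element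
    across [t' * s']. *)
Lemma skein_encircle : t * t * s * p t t' = y ^+ 2 *: (s' * p t t').
Proof.
have <- : t * t * (s * p t t' * s) * s' = t * t * s * p t t'.
  by rewrite !mulrA Kss'.
rewrite rel -scalerAr -scalerAl; congr (_ *: _).
by rewrite !mulrA Ktt' -!mulrA skein_braidVV !mulrA tt' mul1r.
Qed.

(** Expand [rel] and turn [t' * s' * t'] into [s' * t' * s'], so that every term on the right except
    [t' * t'] has at most one factor [t] or [t']. *)
Lemma braidVpV : y ^+ 2 *: (t' * s * t') =
  s * t * s + y *: (s * t' * s) - x *: (s * s)
  - y ^+ 3 *: (s' * t' * s') + (x * y ^+ 2) *: (t' * t').
Proof.
have -> : s * t * s + y *: (s * t' * s) - x *: (s * s) = s * p t t' * s.
  rewrite /skein mulrBr mulrDr mulr_algr -scalerAr !mulrBl mulrDl.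
  by rewrite -!scalerAl.
rewrite rel /skein !mulrBr !mulrDr mulr_algr -scalerAr !mulrBl mulrDl.
rewrite -!scalerAl scalerBr scalerDr !scalerA -exprSr [y ^+ 2 * x]mulrC braidVVV.
by rewrite [RHS](AC 5 (1*(5*3)*(2*4))%AC) /= !subrr !addr0.
Qed.

End Braid.
End AlgebraIdentities.

(** * Generators, relations and commutation in the tower of algebras *)

Section Tower.
Variables (R : comUnitRingType) (p : params R).
Local Notation a := (pa p).
Local Notation x := (px p).
Local Notation y := (py p).
Local Notation br := (tBMW_br p).

Lemma tBMW_brV n (g : braid n) : br g * br g^-1%g = 1.
Proof. by rewrite -tBMW_brM mulgV tBMW_br1. Qed.

Lemma tBMW_brVl n (g : braid n) : br g^-1%g * br g = 1.
Proof. by rewrite -tBMW_brM mulVg tBMW_br1. Qed.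

Lemma tBMW_ind n (P : tBMW p n -> Prop) :
  (forall k u v, P u -> P v -> P (k *: u + v)) -> P 1 ->
  (forall i u, P u -> P (br (artin i) * u) /\ P (br (artin i)^-1%g * u)) ->
  forall u, P u.
Proof.
move=> Plin P1 PM.
have P0 : P 0 by rewrite -(addNr 1) -scaleN1r; exact: Plin.
have Pbr g : P (br g).
  rewrite -(pword_repr g); elim: (repr g) => [|[i e] w IH].
    by rewrite (tBMW_br1 p n : br (pword (@braid_rel n) [::]) = 1).
  rewrite -cat1s pwordM tBMW_brM; case: (PM i _ IH).
  by case: e; rewrite ?pword_inv.
elim/aproj_surj=> z; elim/aproj_surj: z => z.
elim/galg_ind: z => [|k g u IH].
  by rewrite !linear0.
by rewrite !linearP; apply: Plin; first exact: Pbr.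
Qed.

Lemma tBMW1_scalar (u : tBMW p 1) : exists k, u = k%:A.
Proof.
elim/tBMW_ind: u => [k _ _ [l ->] [m ->]||[]//]; last by exists 1; rewrite scale1r.
by exists (k * l + m); rewrite scalerDl scalerA.
Qed.

Lemma tBMW_skein n (i : 'I_n.-1) : let s := artin i in
  br s * skein x y (br s) (br s^-1%g) = a *: skein x y (br s) (br s^-1%g).
Proof.
move=> s; apply: cubic_skein; first exact: tBMW_brV.
have E k : br s - k%:A =
    aproj (bmw_gens p n) (aproj (cubic_gens p n) (gdelta R s - k%:A)).
  by rewrite !rmorphB /= !rmorph_alg.
by rewrite !E -!rmorphM /= (@aproj_eq0 _ _ (cubic_gens p n)) ?linear0 //; exists i.
Qed.

Lemma tBMW_rel n (i j : 'I_n.-1) : j = i.+1 :> nat ->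
  let s := artin i in let t := artin j in
  br s * skein x y (br t) (br t^-1%g) * br s =
  y ^+ 2 *: (br t^-1%g * skein x y (br s) (br s^-1%g) * br t^-1%g).
Proof.
move=> ij s t; have : aproj (bmw_gens p n) (relR p s t) = 0.
  by apply: aproj_eq0; exists i, j.
rewrite /relR lin6 /= -!/(tBMW_br _ _) !expgS !expg0 !mulg1 !invgM !tBMW_brM.
by rewrite relR_skein => /eqP; rewrite subr_eq0 => /eqP.
Qed.

Lemma tBMW_near n (i j : 'I_n.-1) : j = i.+1 :> nat ->
  let s := artin i in let t := artin j in
  br s * (br t * br s) = br t * (br s * br t).
Proof. by move=> ij /=; rewrite -!tBMW_brM artin_near. Qed.

(** On n + 3 strands [low n] and [top n.+1] are the last two generators, and [low n] is the image of
    [top n]. *)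
Local Notation low n := (@artin n.+3 (widen_ord (leq_pred n.+2) ord_max)).
Local Notation top n := (@artin n.+2 ord_max).

Lemma incl_top n : tBMW_incl (br (top n)) = br (low n).
Proof. by rewrite tBMW_inclE braid_incl_artin. Qed.

Lemma incl_topV n : tBMW_incl (br (top n)^-1%g) = br (low n)^-1%g.
Proof. by rewrite tBMW_inclE braid_inclV braid_incl_artin. Qed.

(** The generators of B_(n+1) have indices at least two below that of s_(n+2), so far commutation
    applies. *)
Lemma incl2_comm n (u : tBMW p n.+1) :
  br (top n.+1) * tBMW_incl (tBMW_incl u) = tBMW_incl (tBMW_incl u) * br (top n.+1).
Proof.
elim/tBMW_ind: u => [k u v IHu IHv||i u IH].
- by rewrite !linearP mulrDr mulrDl -scalerAr -scalerAl IHu IHv.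
- by rewrite !rmorph1 mulr1 mul1r.
set w := widen_ord (leq_pred n.+2) (widen_ord (leq_pred n.+1) i).
have E : br (top n.+1) * br (@artin n.+3 w) = br (@artin n.+3 w) * br (top n.+1).
  by rewrite -!tBMW_brM (@artin_far n.+3 w) //; exact: (ltn_ord i).
rewrite !rmorphM /= !tBMW_inclE !braid_inclV !braid_incl_artin -/w.
split; first by rewrite mulrA E -!mulrA IH.
by rewrite mulrA (comm_inv (tBMW_brV _) (tBMW_brVl _) E) -!mulrA IH.
Qed.

Lemma incl2_commV n (u : tBMW p n.+1) :
  br (top n.+1)^-1%g * tBMW_incl (tBMW_incl u) =
  tBMW_incl (tBMW_incl u) * br (top n.+1)^-1%g.
Proof.
apply/esym/(comm_inv (tBMW_brV _) (tBMW_brVl _)).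
by rewrite incl2_comm.
Qed.

(** * Spanning by A + A s A + A s^-1 A, with s the last generator and A the image of the previous
    algebra *)

Inductive tower_span n : tBMW p n.+2 -> Prop :=
| tower_span0 : tower_span 0
| tower_span_lin k u v : tower_span u -> tower_span v -> tower_span (k *: u + v)
| tower_span_incl u : tower_span (tBMW_incl u)
| tower_span_top u e v : tower_span
    (tBMW_incl u * br (if e then (top n)^-1 else top n)%g * tBMW_incl v).

Section SpanClosure.
Variable n : nat.

Lemma tower_spanZ k (u : tBMW p n.+2) : tower_span u -> tower_span (k *: u).
Proof.
by move=> hu; rewrite -[k *: u]addr0; apply: tower_span_lin => //; exact: tower_span0.
Qed.

Lemma tower_spanD (u v : tBMW p n.+2) :
  tower_span u -> tower_span v -> tower_span (u + v).
Proof. by move=> hu hv; rewrite -[u]scale1r; exact: tower_span_lin. Qed.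

Lemma tower_spanN (u : tBMW p n.+2) : tower_span u -> tower_span (- u).
Proof. by move=> hu; rewrite -scaleN1r; exact: tower_spanZ. Qed.

Lemma tower_spanZV k (u : tBMW p n.+2) :
  k \is a GRing.unit -> tower_span (k *: u) -> tower_span u.
Proof. by move=> uk /(tower_spanZ k^-1); rewrite scalerA mulVr // scale1r. Qed.

Lemma tower_span_mull w (u : tBMW p n.+2) :
  tower_span u -> tower_span (tBMW_incl w * u).
Proof.
elim=> [|k u1 u2 _ IH1 _ IH2|u1|u1 e v].
- by rewrite mulr0; exact: tower_span0.
- by rewrite mulrDr -scalerAr; exact: tower_span_lin.
- by rewrite -rmorphM; exact: tower_span_incl.
- by rewrite !mulrA -rmorphM; exact: tower_span_top.
Qed.

Lemma tower_span_mulr w (u : tBMW p n.+2) :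
  tower_span u -> tower_span (u * tBMW_incl w).
Proof.
elim=> [|k u1 u2 _ IH1 _ IH2|u1|u1 e v].
- by rewrite mul0r; exact: tower_span0.
- by rewrite mulrDl -scalerAl; exact: tower_span_lin.
- by rewrite -rmorphM; exact: tower_span_incl.
- by rewrite -mulrA -rmorphM; exact: tower_span_top.
Qed.

Lemma tower_span1 : tower_span (1 : tBMW p n.+2).
Proof. by rewrite -(rmorph1 (@tBMW_incl _ p n.+1)); exact: tower_span_incl. Qed.

Lemma tower_span_topl e v :
  tower_span (br (if e then (top n)^-1 else top n)%g * tBMW_incl v).
Proof.
rewrite -[br _]mul1r -(rmorph1 (@tBMW_incl _ p n.+1)).
exact: tower_span_top.
Qed.

Lemma tower_span_topE e : tower_span (br (if e then (top n)^-1 else top n)%g).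
Proof.
rewrite -[br _]mulr1 -(rmorph1 (@tBMW_incl _ p n.+1)).
exact: tower_span_topl.
Qed.

End SpanClosure.

Hypotheses (ua : a \is a GRing.unit) (uc : pc p \is a GRing.unit).

Let uy : y \is a GRing.unit.
Proof. by rewrite unitrM (pb_unit p) uc. Qed.

Lemma tower_span_invtop2 n e :
  tower_span (br (top n)^-1%g * br (if e then (top n)^-1 else top n)%g).
Proof.
case: e; last by rewrite tBMW_brVl; exact: tower_span1.
apply: (@tower_spanZV _ (a * y)); first by rewrite unitrM ua uy.
rewrite (cubic_inv_sqr (tBMW_brV _) (@tBMW_skein _ _)).
apply: tower_spanD; last exact/tower_spanZ/(tower_span_topE n true).
apply: tower_spanD; last exact/tower_spanN/tower_spanZ/tower_span1.
apply: tower_spanD; last exact/tower_spanN/tower_spanZ/tower_span1.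
exact: (tower_span_topE n false).
Qed.

(* The relation R_(n+1) is what reduces s_(n+2)^-1 s_(n+1) s_(n+2)^-1; the
   three other products are conjugated down by the braid relation alone. *)
Lemma tower_span_top3 n e f :
  tower_span (br (top n.+1)^-1%g * tBMW_incl (br (if e then (top n)^-1 else top n)%g)
    * br (if f then (top n.+1)^-1 else top n.+1)%g).
Proof.
have st : @ord_max n.+1 = (widen_ord (leq_pred n.+2) (@ord_max n)).+1 :> nat by [].
have := @tBMW_rel n.+3 _ _ st; have := @tBMW_near n.+3 _ _ st.
have := tower_span_invtop2 n.+1 true.
have := tower_span_top (br (top n)) _ (br (top n)).
have := tower_span_top (br (top n)) _ (br (top n)^-1%g).
have := tower_span_top (br (top n)^-1%g) _ (br (top n)^-1%g).
have := tower_span_incl (br (top n) * br (top n)).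
rewrite rmorphM /= !incl_top !incl_topV.
have := tBMW_brV (low n); have := tBMW_brVl (low n).
have := tBMW_brV (top n.+1); have := tBMW_brVl (top n.+1).
set t := br (top _); set t' := br (_ (top _)).
set s := br (low _); set s' := br (_ (low _)).
move=> t't tt' s's ss' Tss T3 T2 T1 Tt't' sts rel.
case: e f => [] []; rewrite ?incl_top ?incl_topV -/s -/s' -/t -/t'.
- rewrite (braidVVV ss' s's tt' t't sts); exact: (T3 true).
- rewrite (braidVVp ss' s's tt' t't sts); exact: (T2 true).
- apply: (@tower_spanZV _ (y ^+ 2)); first by rewrite unitrX.
  rewrite (braidVpV ss' s's tt' t't sts rel).
  apply: tower_spanD; last exact: tower_spanZ.
  apply: tower_spanD; last exact/tower_spanN/tower_spanZ/(T3 true).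
  apply: tower_spanD; last exact/tower_spanN/tower_spanZ.
  apply: tower_spanD; [exact: (T1 false)|exact/tower_spanZ/(T1 true)].
- rewrite (braidVpp ss' t't sts); exact: (T2 false).
Qed.

(** The hypothesis makes the span stable under left multiplication by s^-1; stability under s
    follows since the cubic relation writes s through s^-2, s^-1 and 1. *)
Lemma tower_span_all n :
  (forall (u : tBMW p n.+1) e, tower_span
     (br (top n)^-1%g * tBMW_incl u * br (if e then (top n)^-1 else top n)%g)) ->
  forall w : tBMW p n.+2, tower_span w.
Proof.
move=> Tmid.
have TV w : tower_span w -> tower_span (br (top n)^-1%g * w).
  elim=> [|k u1 u2 _ IH1 _ IH2|u|u e v].
  - by rewrite mulr0; exact: tower_span0.
  - by rewrite mulrDr -scalerAr; exact: tower_span_lin.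
  - exact: (tower_span_topl true).
  - by rewrite !mulrA; exact: tower_span_mulr.
elim/tBMW_ind => [k u v||i u IH]; first exact: tower_span_lin.
  exact: tower_span1.
case: (unliftP ord_max i) => [j ->|->]; last first.
  split; last exact: TV.
  set s := br _; set s' := br (top n)^-1%g.
  have E : (a * y) *: (s' * s') = s - x%:A - a%:A + (y + a * x) *: s'.
    exact: cubic_inv_sqr (tBMW_brV _) (@tBMW_skein n.+2 ord_max).
  have -> : s = (a * y) *: (s' * s') - (y + a * x) *: s' + a%:A + x%:A.
    by rewrite E addrK !subrK.
  rewrite !mulrDl mulNr !mulr_algl -!scalerAl -mulrA.
  do 2! [apply: tower_spanD; last exact: tower_spanZ].
  apply: tower_spanD; last exact/tower_spanN/tower_spanZ/TV.
  exact/tower_spanZ/TV/TV.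
have -> : lift ord_max j = widen_ord (leq_pred n.+1) j by exact/val_inj/lift_max.
by rewrite -braid_incl_artin -braid_inclV -!tBMW_inclE; split; exact: tower_span_mull.
Qed.

(** By induction the middle factor [u] is itself in the span one level down; its outer factors
    commute with the new generator, which leaves the products of [tower_span_top3]. *)
Theorem tBMW_tower_span n (w : tBMW p n.+2) : tower_span w.
Proof.
elim: n w => [|n IHn]; apply: tower_span_all => u e.
  case: (tBMW1_scalar u) => k ->.
  rewrite rmorph_alg mulr_algr -scalerAl; apply: tower_spanZ.
  exact: tower_span_invtop2.
elim: (IHn u) => [|k u1 u2 _ IH1 _ IH2|u1|u1 f v].
- by rewrite linear0 mulr0 mul0r; exact: tower_span0.
- by rewrite linearP mulrDr mulrDl -scalerAr -scalerAl; exact: tower_span_lin.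
- rewrite incl2_commV -mulrA; apply: tower_span_mull.
  exact: tower_span_invtop2.
rewrite !rmorphM /= !mulrA incl2_commV -!mulrA; apply: tower_span_mull.
have -> : tBMW_incl (tBMW_incl v) * br (if e then (top n.+1)^-1 else top n.+1)%g =
    br (if e then (top n.+1)^-1 else top n.+1)%g * tBMW_incl (tBMW_incl v).
  by case: e; rewrite ?incl2_comm ?incl2_commV.
rewrite !mulrA; apply: tower_span_mulr; exact: tower_span_top3.
Qed.

End Tower.

(** * The recursion for adding a free strand under a Markov trace *)

Section MarkovTrace.
Variables (R : comUnitRingType) (p : params R) (M : lmodType R).
Variable t : forall n, {linear tBMW p n.+1 -> M}.
Hypothesis tM : is_markov_trace t.
Local Notation a := (pa p).
Local Notation x := (px p).
Local Notation y := (py p).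
Local Notation br := (tBMW_br p).
Local Notation low n := (@artin n.+3 (widen_ord (leq_pred n.+2) ord_max)).
Local Notation top n := (@artin n.+2 ord_max).

Lemma markov_cyclic n (u v : tBMW p n.+1) : t n (u * v) = t n (v * u).
Proof. exact: tM.1. Qed.

Lemma markov_top n e (u v : tBMW p n.+1) :
  t n.+1 (tBMW_incl u * br (if e then (top n)^-1 else top n)%g * tBMW_incl v) =
  t n (v * u).
Proof.
rewrite markov_cyclic mulrA -rmorphM.
by have [h h'] := tM.2 n (v * u); case: e; rewrite ?h ?h'.
Qed.

Lemma markov_skein n (v : tBMW p n.+1) :
  t n.+1 (tBMW_incl v * skein x y (br (top n)) (br (top n)^-1%g)) =
  (1 + y) *: t n v - x *: t n.+1 (tBMW_incl v).
Proof.
have [h h'] := tM.2 n v.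
rewrite /skein mulrBr mulrDr mulr_algr -scalerAr linearB linearD !linearZ /=.
by rewrite h h' scalerDl scale1r.
Qed.

(* Conjugating by s_(n+2) turns s_(n+1) into s_(n+1)^-1 s_(n+2) s_(n+1):
   the split unknot may be moved to any position. *)
Lemma markov_low n e (v : tBMW p n.+1) :
  t n.+2 (tBMW_incl (tBMW_incl v *
                     br (if e then (top n)^-1 else top n)%g)) =
  t n.+1 (tBMW_incl v).
Proof.
have st : @ord_max n.+1 = (widen_ord (leq_pred n.+2) (@ord_max n)).+1 :> nat by [].
have sts := @tBMW_near _ p n.+3 _ _ st.
(* Insert s_(n+2)^-1 s_(n+2) at the end and rotate, which conjugates the argument by s_(n+2). *)
rewrite -[LHS](congr1 (t n.+2) (mulr1 _)) -(tBMW_brVl p (top n.+1)) mulrA markov_cyclic.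
transitivity (t n.+2 (tBMW_incl (tBMW_incl v * br (top n)^-1%g) *
  br (if e then (top n.+1)^-1 else top n.+1)%g * tBMW_incl (br (top n)))).
  rewrite !rmorphM /= !mulrA incl2_comm -!mulrA; congr (t _ (_ * _)).
  have ss' := tBMW_brV p (low n); have s's := tBMW_brVl p (low n).
  have tt' := tBMW_brV p (top n.+1); have t't := tBMW_brVl p (top n.+1).
  case: e; rewrite ?incl_top ?incl_topV !mulrA.
    by rewrite (braidVVp tt' t't ss' s's (esym sts)).
  by rewrite (braidVpp tt' s's (esym sts)).
by rewrite markov_top markov_cyclic -mulrA tBMW_brVl mulr1.
Qed.

(* Evaluates the trace of [v s_(n+2)^2 s_(n+1) q = y^2 v s_(n+1)^-1 q], with
   [q] the skein element of s_(n+2); both traces reduce to the same one. *)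
Lemma markov_unknot n (v : tBMW p n.+1) :
  (a ^+ 2 - y ^+ 2) *: ((1 + y) *: t n v - x *: t n.+1 (tBMW_incl v)) = 0.
Proof.
have st : @ord_max n.+1 = (widen_ord (leq_pred n.+2) (@ord_max n)).+1 :> nat by [].
have ss' := tBMW_brV p (low n); have s's := tBMW_brVl p (low n).
have tt' := tBMW_brV p (top n.+1); have t't := tBMW_brVl p (top n.+1).
have := skein_encircle ss' s's tt' t't (@tBMW_near _ p n.+3 _ _ st)
  (@tBMW_rel _ p n.+3 _ _ st).
have := @tBMW_skein _ p n.+3 ord_max.
have := markov_skein (tBMW_incl v * br (top n)).
have := markov_skein (tBMW_incl v * br (top n)^-1%g).
rewrite (markov_low false) (markov_low true) !rmorphM /= incl_top incl_topV.
have := markov_top false v 1; have := markov_top true v 1.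
rewrite rmorph1 !mulr1 mul1r => -> ->.
have := incl2_comm v; set V := tBMW_incl (tBMW_incl v).
set s := br (low n); set s' := br (low n)^-1%g.
set u := br (top n.+1); set u' := br (top n.+1)^-1%g.
set q := skein x y u u' => uV TV' TV uq rel.
have qu : q * u = a *: q.
  rewrite -uq /q /skein mulrBl mulrDl mulrBr mulrDr mulr_algl mulr_algr.
  by rewrite -scalerAl -scalerAr t't tt'.
rewrite scalerBl; apply/eqP; rewrite subr_eq0; apply/eqP.
(* The left bracket becomes the trace of [V * s * q] and the right one that of [V * s' * q], where
   [rel] applies. *)
rewrite -{1}TV -TV' -!linearZ /= -!mulrA [in RHS]scalerAr -rel.
have Vu w : V * (u * w) = u * (V * w) by rewrite mulrA -uV -mulrA.
(* [u] commutes with [V], so cyclicity brings both copies of [u] behind [q], where each contributes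
   a factor [a]. *)
rewrite -!mulrA !Vu [RHS]markov_cyclic -mulrA [RHS]markov_cyclic.
by rewrite -!mulrA [q * (u * u)]mulrA qu -scalerAl qu scalerA -!scalerAr.
Qed.

Theorem markov_stable n (v : tBMW p n.+1) :
  injective (fun m : M => (a ^+ 2 - y ^+ 2) *: m) ->
  x *: t n.+1 (tBMW_incl v) = (1 + y) *: t n v.
Proof.
move=> inj; apply/esym/eqP; rewrite -subr_eq0; apply/eqP/inj.
by rewrite markov_unknot scaler0.
Qed.

(** The skein element maps to 0 in the Hecke algebra, where y s^-1 = x - s, so the trace in
    [markov_skein] vanishes. *)
Lemma hecke_markov_stable n (v : tBMW p n.+1) :
  (exists f : {linear hecke p n.+2 -> M}, forall u, t n.+1 u = f (tBMW_hecke u)) ->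
  x *: t n.+1 (tBMW_incl v) = (1 + y) *: t n v.
Proof.
move=> [f tf]; apply/esym/eqP; rewrite -subr_eq0 -markov_skein tf rmorphM /=.
have -> : tBMW_hecke (skein x y (br (top n)) (br (top n)^-1%g)) = 0.
  rewrite /skein linearB linearD !linearZ /= rmorph1 !tBMW_heckeE !cubicH_heckeE.
  by rewrite hecke_inv addrCA subrr addr0 scalerN subrr.
by rewrite mulr0 linear0.
Qed.

End MarkovTrace.

(** * Modules over the localization and comparison of the two traces *)

Section LocalizedAction.
Variables (A : idomainType) (f : A) (M : lmodType A).
Hypothesis fM : bijective (fun m : M => f *: m).

Lemma loc_actZ k (z : loc f) (m : M) : loc_act (k *: z) m = k *: loc_act z m.
Proof. by rewrite loc_scaleE -loc_actA // loc_act_in. Qed.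

Lemma loc_act0 (m : M) : loc_act (0 : loc f) m = 0.
Proof. by rewrite -(rmorph0 (locin f)) loc_act_in // scale0r. Qed.

End LocalizedAction.

(** Separates the factors of x (a^2 - y^2): [loc_act] requires the first to act bijectively,
    [markov_stable] the second injectively. *)
Lemma bijective_scale_mul (A : comNzRingType) (M : lmodType A) (f g : A) :
  bijective (fun m : M => (f * g) *: m) ->
  bijective (fun m : M => f *: m) /\ injective (fun m : M => g *: m).
Proof.
move=> [h hK Kh]; split; last first.
  by move=> m m' e; rewrite -[m]hK -[m']hK -!scalerA e.
exists (fun m => g *: h m) => m; last by rewrite scalerA Kh.
apply: (can_inj hK) => /=.
by rewrite scalerA mulrC -[LHS]scalerA Kh scalerA mulrC.
Qed.

Theorem corollary5p6 (M : lmodType Rabc)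
    (t : forall n, {linear tBMW abc n.+1 -> M})
    (tH : forall n, {linear tBMW abc n.+1 -> Sabc}) :
  is_markov_trace t ->
  is_ocneanu_trace tH ->
  bijective (fun m : M => (vx * (va ^+ 2 - vy ^+ 2)) *: m) ->
  bijective (fun m : M => (vx ^+ 2 * (va ^+ 2 - vy)) *: m) ->
  exists m : M, forall n (beta : tBMW abc n.+1),
    t n beta = loc_act (tH n beta) m.
Proof.
move=> tM [tHM tHf tH1] /bijective_scale_mul[xM aM] _.
have [ua _ uc] := vabc_unit.
(* The only possible [m], since [tH] takes the value 1 at 1 on one strand. *)
exists (t 0%N 1); elim=> [|n IH] beta.
  case: (tBMW1_scalar beta) => k ->.
  by rewrite !linearZ /= tH1 loc_actZ // loc_act1.
elim: (tBMW_tower_span (p := abc) ua uc beta) => [|k u v _ IHu _ IHv|u|u e v].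
- by rewrite !linear0 loc_act0.
- by rewrite !linearP IHu IHv loc_actDl // loc_actZ.
(* Both traces satisfy the same recursion for a free strand, with x on the left, and x can be
   cancelled in [M]. *)
- apply: (bij_inj xM) => /=.
  rewrite (markov_stable tM u aM) -loc_actZ // (hecke_markov_stable tHM u (tHf _)).
  by rewrite loc_actZ // IH.
- by rewrite (markov_top tM) (markov_top tHM) IH.
Qed.
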